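(* Let $d\in\mathbb{N}$ and $-1<q<1$, and let $A=(A_1,\ldots,A_d)$ be the $q$-Gaussians on the $q$-deformed Fock space $\mathcal{F}_q(H)$, $\dim H=d$, with vacuum state $\tau_q$. Then there exists a normalized dual system for $A$, and thus also a conjugate system $(\xi_1,\ldots,\xi_d)$ for $A$ (with respect to $\tau_q$). Furthermore, the conjugate system is Lipschitz conjugate.
   Context: **$q$-Gaussians.** Let $-1<q<1$, $d\in\mathbb{N}$ ($d\ge 1$), $[d]=\{1,\dots,d\}$, and let $H$ be a $d$-dimensional complex Hilbert space with orthonormal basis $e_1,\dots,e_d$. Let $[d]^*$ be the set of finite words in the alphabet $[d]$, with empty word denoted $0$ and length $|w|$. The algebraic Fock space is $\mathcal{F}_{\mathrm{alg}}(H)=\bigoplus_{n\ge0}H^{\otimes n}$ (algebraic direct sum), with $H^{\otimes 0}=\mathbb{C}e_0$, $e_0$ a unit vector (vacuum); it has linear basis $e_w=e_{w_1}\otimes\cdots\otimes e_{w_n}$, $w=w_1\cdots w_n\in[d]^*$. Define $P^{(n)}e_w=\sum_{\pi\in S_n}q^{|\pi|}e_{w_{\pi(1)}\cdots w_{\pi(n)}}$ for $|w|=n$, where $|\pi|$ is the number of inversions of $\pi$. The inner product $\langle\xi,\eta\rangle_q=\langle\xi,\bigoplus_nP^{(n)}\eta\rangle$ is strictly positive; $\mathcal{F}_q(H)$ is the completion. The left creation operators $l_i^*e_w=e_{iw}$ are bounded on $\mathcal{F}_q(H)$; $l_i$ denotes the adjoint of $l_i^*$, given by $l_ie_0=0$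 and $l_ie_{j_n\cdots j_1}=\sum_{k=1}^nq^{n-k}\delta_{ij_k}e_{j_n\cdots\check{j_k}\cdots j_1}$ ($\check{j_k}$ means $j_k$ is omitted). The $q$-Gaussians are $A_i=l_i+l_i^*$, and $W^*(A)\subset B(\mathcal{F}_q(H))$ is the von Neumann algebra they generate. The vacuum state $\tau_q(T)=\langle Te_0,e_0\rangle_q$ is a faithful normal tracial state on $W^*(A)$. The Hilbert space $L^2(W^*(A),\tau_q)$ is identified with $\mathcal{F}_q(H)$ via $T\mapsto Te_0$ (so $1\leftrightarrow e_0$); under this map $\mathbb{C}\langle A\rangle$ (the algebra of noncommutative polynomials in $A_1,\dots,A_d$) corresponds bijectively to $\mathcal{F}_{\mathrm{alg}}(H)$, and $A_1,\dots,A_d$ are algebraically free. **Normalized dual system.** For self-adjoint $X=(X_1,\dots,X_d)$ in a tracial $W^*$-probability space with trace $\tau$, a normalized dual system is a tuple $(D_1,\dots,D_d)$ of (unbounded) operators on $L^2(W^*(X),\tau)$ whose domains contain $\mathbb{C}\langle X\rangle$ and such that $D_i1=0$, $1\in\mathrm{dom}(D_i^* )$, and $[D_i,X_j]=\delta_{ij}P$ on $\mathbb{C}\langle X\rangle$ for all $i,j\in[d]$, where $P$ is the orthogonal projection onto $\mathbb{C}1$. **Conjugate system.** The free difference quotients $\partial_i:\mathbb{C}\langle x_1,\dots,x_d\rangle\to\mathbb{C}\langle x_1,\dots,x_d\rangle^{\otimes2}$ are the linear maps determined by the Leibniz rule and $\partial_ix_j=\delta_{ij}1\otimes1$. A tuple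 $(\xi_1,\dots,\xi_d)\in L^2(W^*(X),\tau)^d$ is a conjugate system for $X$ if $\tau(Q(X)\xi_i)=(\tau\otimes\tau)[(\partial_iQ)(X)]$ for all $i\in[d]$ and $Q\in\mathbb{C}\langle x_1,\dots,x_d\rangle$, where $\tau(Q(X)\xi):=\langle Q(X)\xi,1\rangle$ for $\xi\in L^2$. It is unique if it exists. **Lipschitz conjugate.** When $X$ is algebraically free, $\partial_j$ is viewed as an unbounded operator $L^2(W^*(X),\tau)\to L^2(W^*(X),\tau)\otimes L^2(W^*(X),\tau)$ with domain $\mathbb{C}\langle X\rangle$; if a conjugate system exists, $\partial_j$ is closable, with closure $\overline{\partial_j}$. The conjugate system is called Lipschitz conjugate if $\xi_i\in\mathrm{dom}(\overline{\partial_j})$ and $\overline{\partial_j}\xi_i\in W^*(X)\overline{\otimes}W^*(X)$ (von Neumann algebra tensor product, viewed in its $L^2$-space) for all $i,j\in[d]$. *)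

(* Defs.v *)
From HB Require Import structures.
From mathcomp Require Import all_boot all_order all_algebra fingroup perm.
From mathcomp Require Import finmap complex.
From mathcomp Require Import all_classical all_reals all_analysis.
(* monalg and mathcomp-analysis declare clashing notations. *)
From mathcomp Require Import -(notations) monalg.
Set Implicit Arguments.
Unset Strict Implicit.
Unset Printing Implicit Defensive.
Import Order.TTheory GRing.Theory Num.Theory.
Import numFieldNormedType.Exports.
Local Open Scope classical_set_scope.
Local Open Scope ring_scope.
Local Open Scope complex_scope.

(* The inner product is linear in its first and antilinear in its second
   argument. *)
HB.mixin Record CompleteNormedModule_isHilbert (R : realType) V
    of CompleteNormedModule R[i] V := {
  hdot : {dot V for @Num.conj R[i]};
  hdot_norm : forall x : V, hdot x x = `|x| ^+ 2
}.

#[short(type="hilbertType")]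
HB.structure Definition Hilbert (R : realType) :=
  {V of CompleteNormedModule R[i] V & CompleteNormedModule_isHilbert R V}.

(* Linear extension of g from the basis K of the free module malg K R[i]. *)
Definition mlin (R : realType) (K : choiceType) (V : lmodType R[i])
    (g : K -> V) (x : malg K R[i]) : V :=
  \sum_(k <- msupp x) mcoeff k x *: g k.

Section MlinTheory.
Variables (R : realType) (K : choiceType) (V : lmodType R[i]) (g : K -> V).

Lemma mlinEw (E : {fset K}) (x : malg K R[i]) : (msupp x `<=` E)%fset ->
  mlin g x = \sum_(k <- E) mcoeff k x *: g k.
Proof.
move=> le; rewrite [LHS](big_fset_incl _ le) //= => k _ /mcoeff_outdom ->.
by rewrite scale0r.
Qed.

Lemma mlin_is_linear : linear (mlin g).
Proof.
move=> a x y; pose E := (msupp (a *: x + y)%R `|` (msupp x `|` msupp y))%fset.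
rewrite !(@mlinEw E) ?fsubsetUl //;
  try by rewrite /E !(fsubsetU, fsubset_refl, orbT).
rewrite scaler_sumr -big_split /=; apply: eq_bigr => k _.
by rewrite mcoeffD mcoeffZ scalerDl scalerA.
Qed.

HB.instance Definition _ :=
  GRing.isLinear.Build R[i] (malg K R[i]) V *:%R (mlin g) mlin_is_linear.

Lemma mlin_basis k : mlin g (mkmalgU k 1) = g k.
Proof.
by rewrite (mlinEw msuppU_le) big_seq_fset1 mcoeffUU scale1r.
Qed.

End MlinTheory.

Lemma malg_basis_ind (R : realType) (K : choiceType) (P : malg K R[i] -> Prop) :
  P 0 -> (forall k, P (mkmalgU k 1)) ->
  (forall (a : R[i]) x y, P x -> P y -> P (a *: x + y)) ->
  forall x, P x.
Proof.
move=> P0 Pb Pl x; rewrite (monalgE x).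
elim/big_rec: _ => // k y _ Py.
suff -> : mkmalgU k (mcoeff k x) = mcoeff k x *: mkmalgU k 1 by exact: Pl.
by apply/malgP => l; rewrite mcoeffZ !mcoeffU mulrnAr mulr1.
Qed.

Lemma malg_scalerAr (R : realType) (K : monomType) (a : R[i]) (x y : malg K R[i]) :
  x * (a *: y) = a *: (x * y).
Proof.
rewrite !malgM_def (fgmullw (fsubset_refl _) (msuppZ_le a y)) fgmull.
rewrite !scaler_sumr; apply: eq_bigr => k _.
rewrite scaler_sumr; apply: eq_bigr => l _.
apply/malgP => m; rewrite mcoeffZ mcoeffU mcoeffZ mulrCA -mulrnAr; congr (_ * _).
by rewrite mcoeffU.
Qed.

Section MonomPair.
Variables M N : monomType.
Implicit Types x y z : (M * N)%type.

Let pone : (M * N)%type := (mone, mone).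
Let pmul x y : (M * N)%type := (mmul x.1 y.1, mmul x.2 y.2).

Let pmulA : associative pmul.
Proof. by move=> x y z; rewrite /pmul /= !mulmA. Qed.

Let pmul1m : left_id pone pmul.
Proof. by case=> x y; rewrite /pmul /= !mul1m. Qed.

Let pmulm1 : right_id pone pmul.
Proof. by case=> x y; rewrite /pmul /= !mulm1. Qed.

Let punit x y : pmul x y = pone -> x = pone /\ y = pone.
Proof.
by case: x y => [x1 x2] [y1 y2] [/unitm[-> ->] /unitm[-> ->]].
Qed.

HB.instance Definition _ :=
  Choice_isMonomialDef.Build (M * N)%type pmulA pmul1m pmulm1 punit.

End MonomPair.

(* Noncommutative polynomials in x_1, ..., x_d are the algebra of the free
   monoid on 'I_d; the algebraic tensor square is the algebra of the square of
   that monoid, with a (x) b = (a (x) 1) * (1 (x) b). *)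
Notation ncpoly R d := (malg (fmonom 'I_d) R[i]).
Notation ncpoly2 R d := (malg (fmonom 'I_d * fmonom 'I_d)%type R[i]).

Definition ncvar (R : realType) (d : nat) (i : 'I_d) : ncpoly R d :=
  mkmalgU (fmu i) 1.

Definition tensl (R : realType) (d : nat) : ncpoly R d -> ncpoly2 R d :=
  mlin (fun u => mkmalgU (u, mone) 1).

Definition tensr (R : realType) (d : nat) : ncpoly R d -> ncpoly2 R d :=
  mlin (fun v => mkmalgU (mone, v) 1).

(* The free difference quotient; [fdq_var] and [fdq_leibniz] below are its
   defining properties. *)
Definition fdq_word (R : realType) (d : nat) (i : 'I_d) (w : fmonom 'I_d) :
    ncpoly2 R d :=
  \sum_(k < size w | tnth (in_tuple w) k == i)
     mkmalgU (FMonom (take k w), FMonom (drop k.+1 w)) 1.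

Lemma fdq_wordE (R : realType) (d : nat) (i : 'I_d) (w : fmonom 'I_d) (s : seq 'I_d) :
  w = s :> seq 'I_d -> fdq_word R i w =
  \sum_(0 <= k < size s | nth i s k == i)
    mkmalgU (FMonom (take k s), FMonom (drop k.+1 s)) 1.
Proof.
move=> <-; rewrite /fdq_word big_mkord; apply: eq_bigl => k.
by rewrite (tnth_nth i).
Qed.

Definition fdq (R : realType) (d : nat) (i : 'I_d) : ncpoly R d -> ncpoly2 R d :=
  mlin (fdq_word R i).

Lemma fdq_var (R : realType) (d : nat) (i j : 'I_d) :
  fdq i (ncvar R j) = (i == j)%:R.
Proof.
rewrite /fdq /ncvar mlin_basis (@fdq_wordE _ _ i _ [:: j]) /=; last by rewrite fmU.
rewrite big_mkcond big_nat1 (eq_sym i j).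
have -> : nth i [:: j] 0 = j by [].
case: (j == i); last by [].
have fm0 : FMonom [::] = mone :> fmonom 'I_d by apply/eqP; rewrite fmP fm1.
by rewrite fm0.
Qed.

Lemma fdq_word_mul (R : realType) (d : nat) (i : 'I_d) (u v : fmonom 'I_d) :
  fdq_word R i (mmul u v) =
  fdq_word R i u * mkmalgU (mone, v) 1 + mkmalgU (u, mone) 1 * fdq_word R i v.
Proof.
rewrite (fdq_wordE _ i (fmM u v)) (fdq_wordE _ i (erefl (u : seq _))) (fdq_wordE _ i (erefl (v : seq _))).
rewrite size_cat (big_cat_nat _ (n := size u)) ?leq_addr //=; congr (_ + _).
  rewrite mulr_suml big_nat_cond [RHS]big_nat_cond.
  apply: eq_big => [k|k /andP[/andP[_ ku] _]].
    by case: ltnP => //= ku; rewrite nth_cat ku.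
  rewrite [RHS]fgmulUU mulr1; congr mkmalgU; congr pair => /=; apply/eqP.
    by rewrite fmP fmM fm1 cats0 /= takel_cat ?(ltnW ku).
  rewrite fmP fmM /= drop_cat; case: ltnP => // uk.
  have -> : k.+1 = size u by apply/eqP; rewrite eqn_leq ku.
  by rewrite subnn drop0 drop_size.
rewrite -{1}[size u]add0n big_addn addKn mulr_sumr.
apply: eq_big => [k|k _].
  by rewrite nth_cat ltnNge leq_addl addnK.
rewrite [RHS]fgmulUU mulr1; congr mkmalgU; congr pair => /=; apply/eqP.
  by rewrite fmP fmM /= take_cat ltnNge leq_addl addnK.
rewrite fmP fmM fm1 /= drop_cat ltnNge (leq_trans (leq_addl k _) (leqnSn _)) /=.
by rewrite -addSn addnK.
Qed.

Lemma malg_bilinear_ext (R : realType) (K L : choiceType) (V : lmodType R[i])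
    (f g : malg K R[i] -> malg L R[i] -> V) :
  (forall x, linear (f x)) -> (forall y, linear (f ^~ y)) ->
  (forall x, linear (g x)) -> (forall y, linear (g ^~ y)) ->
  (forall k l, f (mkmalgU k 1) (mkmalgU l 1) = g (mkmalgU k 1) (mkmalgU l 1)) ->
  forall x y, f x y = g x y.
Proof.
have lin0 (U : lmodType R[i]) (h : U -> V) : linear h -> h 0 = 0.
  by move=> /(_ (-1) 0 0); rewrite scaleN1r oppr0 addr0 scaleN1r addNr.
move=> fr fl gr gl fg x y.
elim/malg_basis_ind: x => [|k|a x x' IH IH'].
- by rewrite (lin0 _ _ (fl y)) (lin0 _ _ (gl y)).
- elim/malg_basis_ind: y => [|l|a y y' IH IH'].
  + by rewrite (lin0 _ _ (fr _)) (lin0 _ _ (gr _)).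
  + exact: fg.
  + by rewrite fr gr IH IH'.
- by rewrite (fl y) (gl y) IH IH'.
Qed.

Lemma fdq_leibniz (R : realType) (d : nat) (i : 'I_d) (P Q : ncpoly R d) :
  fdq i (P * Q) = fdq i P * tensr Q + tensl P * fdq i Q.
Proof.
have mulPl (K : monomType) (a : R[i]) (x y z : malg K R[i]) :
    (a *: x + y) * z = a *: (x * z) + y * z.
  by rewrite mulrDl -scalerAl.
have mulPr (K : monomType) (a : R[i]) (x y z : malg K R[i]) :
    z * (a *: x + y) = a *: (z * x) + z * y.
  by rewrite mulrDr malg_scalerAr.
have mulDPl (K : monomType) (a : R[i]) (x y z t u v : malg K R[i]) :
    (a *: x + y) * z + (a *: t + u) * v =
    a *: (x * z + t * v) + (y * z + u * v).
  by rewrite mulPl (mulPl _ _ t u) scalerDr addrACA.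
have mulDPr (K : monomType) (a : R[i]) (x y z t u v : malg K R[i]) :
    z * (a *: x + y) + v * (a *: t + u) =
    a *: (z * x + v * t) + (z * y + v * u).
  by rewrite mulPr (mulPr _ _ t u) scalerDr addrACA.
have fdP (a : R[i]) (x y : ncpoly R d) :
  fdq i (a *: x + y) = a *: fdq i x + fdq i y by exact: mlin_is_linear.
have tlP (a : R[i]) (x y : ncpoly R d) :
  tensl (a *: x + y) = a *: tensl x + tensl y by exact: mlin_is_linear.
have trP (a : R[i]) (x y : ncpoly R d) :
  tensr (a *: x + y) = a *: tensr x + tensr y by exact: mlin_is_linear.
pose f (x y : ncpoly R d) := fdq i (x * y).
pose g (x y : ncpoly R d) := fdq i x * tensr y + tensl x * fdq i y.
apply: (@malg_bilinear_ext R _ _ _ f g) => [x a y z|y a x z|x a y z|y a x z|k l].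
- by rewrite /f mulPr; exact: mlin_is_linear.
- by rewrite /f mulPl; exact: mlin_is_linear.
- rewrite /g trP fdP; exact: mulDPr.
- rewrite /g tlP fdP; exact: mulDPl.
- have mulUU : mkmalgU k 1 * mkmalgU l 1 = mkmalgU (mmul k l) 1 :> ncpoly R d.
    by rewrite malgM_def fgmulUU mulr1.
  have fdqU w : fdq i (mkmalgU w 1) = fdq_word R i w by exact: mlin_basis.
  have tlU : tensl (mkmalgU k 1) = mkmalgU (k, mone) 1 :> ncpoly2 R d.
    exact: mlin_basis.
  have trU : tensr (mkmalgU l 1) = mkmalgU (mone, l) 1 :> ncpoly2 R d.
    exact: mlin_basis.
  by rewrite /f mulUU /g !fdqU tlU trU fdq_word_mul.
Qed.

(* The algebraic Fock space F_alg(C^d) has basis e_w, w a word on 'I_d; the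
   vacuum is e_w for the empty word. *)
Notation fock_alg R d := (malg (fmonom 'I_d) R[i]).

Definition fock_basis (R : realType) (d : nat) (w : fmonom 'I_d) : fock_alg R d :=
  mkmalgU w 1.

Definition inversions (n : nat) (s : 'S_n) : nat :=
  #|[set p : 'I_n * 'I_n | (p.1 < p.2)%N && (s p.2 < s p.1)%N]|.

Definition perm_word (d : nat) (w : fmonom 'I_d) (s : 'S_(size w)) :
    fmonom 'I_d :=
  FMonom [seq tnth (in_tuple w) (s k) | k <- enum 'I_(size w)].

Definition q_symmetrizer (R : realType) (d : nat) (q : R) :
    fock_alg R d -> fock_alg R d :=
  mlin (fun w : fmonom 'I_d => \sum_(s : 'S_(size w))
    (q ^+ inversions s)%:C *: fock_basis R (perm_word s)).

Definition fock_dot (R : realType) (d : nat) (x y : fock_alg R d) : R[i] :=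
  \sum_(w <- msupp x) mcoeff w x * (mcoeff w y)^*.

Definition fock_qdot (R : realType) (d : nat) (q : R) (x y : fock_alg R d) : R[i] :=
  fock_dot x (q_symmetrizer q y).

(* (F, iota) is the completion F_q(H) of the algebraic Fock space. *)
Definition q_fock_space (R : realType) (d : nat) (q : R) (F : hilbertType R)
    (iota : {linear fock_alg R d -> F}) : Prop :=
  (forall x y, hdot (iota x) (iota y) = fock_qdot q x y) /\ dense (range iota).

Definition bounded_op (R : realType) (V W : hilbertType R) (S : V -> W) : Prop :=
  linear S /\ continuous S.

Definition adjoint (R : realType) (V W : hilbertType R) (S : V -> W)
    (S' : W -> V) : Prop :=
  forall x y, hdot (S x) y = hdot x (S' y).

Definition q_gaussians (R : realType) (d : nat) (F : hilbertType R)
    (iota : {linear fock_alg R d -> F}) (A : 'I_d -> F -> F) : Prop :=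
  forall i, exists l lstar : F -> F,
    [/\ bounded_op lstar,
        forall w, lstar (iota (fock_basis R w)) =
                  iota (fock_basis R (mmul (fmu i) w)),
        bounded_op l,
        adjoint lstar l &
        forall x, A i x = l x + lstar x].

Definition wot_closed (R : realType) (V : hilbertType R) (M : set (V -> V)) : Prop :=
  forall S, bounded_op S ->
    (forall (s : seq (V * V)) (e : R), 0 < e ->
      exists2 S', M S' &
        forall p, p \in s -> `|hdot (S p.1 - S' p.1) p.2| < e%:C) ->
    M S.

Record von_neumann_algebra (R : realType) (V : hilbertType R)
    (M : set (V -> V)) : Prop := {
  vna_bounded : forall S, M S -> bounded_op S;
  vna_id : M id;
  vna_lin : forall (a : R[i]) S S', M S -> M S' -> M (fun x => a *: S x + S' x);
  vna_comp : forall S S', M S -> M S' -> M (S \o S');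
  vna_star : forall S S', M S -> bounded_op S' -> adjoint S S' -> M S';
  vna_wot : wot_closed M
}.

Definition vna_generated (R : realType) (V : hilbertType R)
    (G : set (V -> V)) : set (V -> V) :=
  [set S | forall M, von_neumann_algebra M -> G `<=` M -> M S].

(* (T, tens) is the Hilbert space tensor product of V and W. *)
Definition hilbert_tensor (R : realType) (V W T : hilbertType R)
    (tens : {bilinear V -> W -> T}) : Prop :=
  (forall a b c e, hdot (tens a b) (tens c e) = hdot a c * hdot b e) /\
  dense (range (fun s : seq (V * W) => \sum_(p <- s) tens p.1 p.2)).

Definition vna_tensor (R : realType) (V W T : hilbertType R)
    (tens : {bilinear V -> W -> T}) (M : set (V -> V)) (N : set (W -> W)) :
    set (T -> T) :=
  vna_generated [set S | bounded_op S /\ exists a b,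
    [/\ M a, N b & forall x y, S (tens x y) = tens (a x) (b y)]].

Record unbounded_op (R : realType) (V W : hilbertType R) := UnboundedOp {
  udom : set V;
  uop : V -> W;
  udom0 : udom 0;
  udom_lin : forall (a : R[i]) x y, udom x -> udom y -> udom (a *: x + y);
  uop_lin : forall (a : R[i]) x y, udom x -> udom y ->
    uop (a *: x + y) = a *: uop x + uop y
}.

Definition in_adjoint_dom (R : realType) (V W : hilbertType R)
    (D : unbounded_op V W) (y : W) : Prop :=
  exists z, forall x, udom D x -> hdot (uop D x) y = hdot x z.

(* Applied to a linear graph G, this says that the closure of G is the graph of
   an operator; in particular G itself is one. *)
Definition closable (R : realType) (V W : hilbertType R)
    (G : set (V * W)) : Prop :=
  forall y, closure G (0, y) -> y = 0.

Section TracialTuple.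
(* X is a tuple of self-adjoint operators on V = L^2(W*(X), tau), and e0 is the
   unit vector of V corresponding to 1, so that T in W*(X) corresponds to T e0
   and tau(T) = <T e0, e0>. *)
Variables (R : realType) (d : nat) (V : hilbertType R).
Variables (X : 'I_d -> V -> V) (e0 : V).

Definition vn_alg : set (V -> V) := vna_generated (range X).

Definition trace (S : V -> V) : R[i] := hdot (S e0) e0.

Definition word_eval (w : fmonom 'I_d) : V -> V := fun v => foldr X v w.

Definition nc_eval (Q : ncpoly R d) : V -> V :=
  fun v => mlin (fun w => word_eval w v) Q.

Definition nc_alg : set V := range (fun Q => nc_eval Q e0).

Definition trace2 (Z : ncpoly2 R d) : R[i] :=
  \sum_(p <- msupp Z) mcoeff p Z * (trace (word_eval p.1) * trace (word_eval p.2)).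

Definition proj_unit (x : V) : V := hdot x e0 *: e0.

Definition normalized_dual_system (D : 'I_d -> unbounded_op V V) : Prop :=
  forall i,
    [/\ nc_alg `<=` udom (D i),
        uop (D i) e0 = 0,
        in_adjoint_dom (D i) e0 &
        forall j x, nc_alg x ->
          uop (D i) (X j x) - X j (uop (D i) x) =
          if i == j then proj_unit x else 0].

Definition conjugate_system (xi : 'I_d -> V) : Prop :=
  forall i (Q : ncpoly R d), hdot (nc_eval Q (xi i)) e0 = trace2 (fdq i Q).

Variables (T : hilbertType R) (tens : {bilinear V -> V -> T}).

Definition fdq_eval (j : 'I_d) (Q : ncpoly R d) : T :=
  mlin (fun p => tens (word_eval p.1 e0) (word_eval p.2 e0)) (fdq j Q).

Definition fdq_graph (j : 'I_d) : set (V * T) :=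
  range (fun Q => (nc_eval Q e0, fdq_eval j Q)).

Definition lipschitz_conjugate (xi : 'I_d -> V) : Prop :=
  forall j, closable (fdq_graph j) /\
    forall i, exists2 S, vna_tensor tens vn_alg vn_alg S &
      closure (fdq_graph j) (xi i, S (tens e0 e0)).

End TracialTuple.

(* Main.v *)
Require Import Defs.
From HB Require Import structures.
From mathcomp Require Import all_boot all_order all_algebra fingroup perm.
From mathcomp Require Import finmap complex.
From mathcomp Require Import all_classical all_reals all_analysis.
From mathcomp Require Import -(notations) monalg.
From mathcomp Require Import zify ring lra.
Set Implicit Arguments.
Unset Strict Implicit.
Unset Printing Implicit Defensive.
Import Order.TTheory GRing.Theory Num.Theory.
Import numFieldNormedType.Exports.
Local Open Scope classical_set_scope.
Local Open Scope ring_scope.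
Local Open Scope complex_scope.

(* Let L, l (resp. R, r) be creation and annihilation on the left (resp. right) of
   words, so that A_j = l_j + L_j and [l_j, R_a] = [r_a, L_j] = delta_ja q^N. Put
   D_i e_w = sum over factorizations w = u i v of c_|v| r_v e_u, where
   c_n = (-1)^n q^(n(n+1)/2). The commutator of r_v with L_j and the letters that
   l_j deletes from v cancel because c_n = - q^n c_(n-1), so [D_i, A_j] = delta_ij P.

   The functional x |-> <D_i x, e0> vanishes on e_w unless |w| = 2m+1, and there it
   is at most |c_m| C^|w|. The Gram matrix of the words of length n is invertible,
   with an inverse bounded by K^n (factorize sum_i L_i l_i through cyclic rotations,
   which turns it into the convergent product of (1 + |q|^k) / (1 - |q|^(k+1))), so
   the superexponential decay of c_m makes the functional bounded and yields the
   conjugate variable xi_i = D_i^* e0 as a norm convergent series.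

   Only exponential factors are lost when e_w is written as a polynomial in A and
   differentiated, so d_j xi_i is a norm convergent series of operators in the tensor
   product. Closability follows from the Leibniz rule and right multiplication by
   A_j, which is the bounded operator r_j + R_j. *)

(** * Hilbert spaces over R[i] with real-valued norms *)

(** The rule for c_n is forced. In w = u i v, l_j deletes the letter j at position k of v, counted
    from 0, with weight q^(|u|+1+k), while [r_v, L_j] on R_u e0 yields the same deletion with weight
    q^(|u|+1-|v|+k). For q nonzero the two cancel exactly when c_n q^(-n) + c_(n-1) = 0. The
    identities are stated without division by q, so that q = 0 is covered. Words are not orthogonal,
    so small values of the functional on words do not by themselves bound it: its vector has to be
    expanded in the basis dual to the words, and the growth of that basis has to be controlled. An
    exponential rate is enough, since |c_m| = |q|^(m(m+1)/2). Hence all sizes can be measured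
    crudely, by the sum of the absolute coefficients over words of a fixed length. This measure
    passes through any linear construction that is understood on single words, so the same
    bookkeeping serves norms in the Fock space and operators on the tensor square. *)

Section RealNorm.
Variables (R : realType) (V : normedZmodType R[i]).
Implicit Types x y : V.

(** Norms are elements of [R[i]], whose order is partial; the estimates below are carried out in
    [R]. *)
Definition rnorm x : R := complex.Re `|x|.

Lemma rnormE x : `|x| = (rnorm x)%:C.
Proof. by rewrite RRe_real // normr_real. Qed.

Lemma rnorm_ge0 x : 0 <= rnorm x.
Proof. by rewrite -ler0c -rnormE. Qed.

Lemma rnorm0 : rnorm (0 : V) = 0.
Proof. by apply: complexI; rewrite -rnormE normr0. Qed.

Lemma rnorm0_eq0 x : rnorm x <= 0 -> x = 0.
Proof.
move=> h; apply/eqP; rewrite -normr_eq0 rnormE eq_le -[0]/(0%:C) !lecR h.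
exact: rnorm_ge0.
Qed.

Lemma rnormD x y : rnorm (x + y) <= rnorm x + rnorm y.
Proof. by rewrite -lecR rmorphD /= -!rnormE ler_normD. Qed.

Lemma rnormN x : rnorm (- x) = rnorm x.
Proof. by rewrite /rnorm normrN. Qed.

Lemma rnormB x y : rnorm (x - y) <= rnorm x + rnorm y.
Proof. by rewrite (le_trans (rnormD _ _)) // rnormN. Qed.

Lemma rnorm_distC x y : rnorm (x - y) = rnorm (y - x).
Proof. by rewrite -rnormN opprB. Qed.

Lemma rnorm_distD x y z : rnorm (x - z) <= rnorm (x - y) + rnorm (y - z).
Proof. by rewrite -[x - z](subrKA y); exact: rnormD. Qed.

Lemma rnorm_sum (I : Type) (s : seq I) (f : I -> V) :
  rnorm (\sum_(k <- s) f k) <= \sum_(k <- s) rnorm (f k).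
Proof.
elim/big_ind2: _ => [|? ? ? ? h1 h2|//]; first by rewrite rnorm0.
by rewrite (le_trans (rnormD _ _)) // lerD.
Qed.

End RealNorm.

Lemma rnorm_real (R : realType) (a : R) : rnorm a%:C = `|a|.
Proof. by rewrite /rnorm normc_def /= expr0n addr0 sqrtr_sqr. Qed.

Lemma rnormZ (R : realType) (V : normedModType R[i]) (a : R[i]) (x : V) :
  rnorm (a *: x) = rnorm a * rnorm x.
Proof. by apply: complexI; rewrite rmorphM /= -!rnormE normrZ. Qed.

Lemma rnormZr (R : realType) (V : normedModType R[i]) (a : R) (x : V) :
  rnorm (a%:C *: x) = `|a| * rnorm x.
Proof. by rewrite rnormZ rnorm_real. Qed.

(** Density arguments end here: the approximation error e is arbitrary, K is fixed, and a
    nonpositive norm vanishes. *)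
Lemma le0_small (R : realType) (a K : R) :
  (forall e, 0 < e -> a <= K * e) -> a <= 0.
Proof.
move=> h; rewrite leNgt; apply/negP => a0.
have K0 : 0 < `|K| + 1 by rewrite ltr_wpDl.
have := h (a / (2 * (`|K| + 1))); rewrite divr_gt0 ?mulr_gt0 // => /(_ isT).
rewrite leNgt => /negP; apply.
apply: (@le_lt_trans _ _ ((`|K| + 1) * (a / (2 * (`|K| + 1))))).
  rewrite ler_wpM2r ?divr_ge0 ?mulr_ge0 ?(ltW a0) ?(ltW K0) //.
  by rewrite (le_trans (ler_norm K)) // lerDl.
have -> : (`|K| + 1) * (a / (2 * (`|K| + 1))) = a / 2 by field; rewrite gt_eqF.
by rewrite ltr_pdivrMr // ltr_pMr // ltr1n.
Qed.

Lemma conjcM (R : realType) (a b : R[i]) : conjc (a * b) = conjc a * conjc b.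
Proof. exact: rmorphM. Qed.

Section Linear.
Variables (R : realType) (V W : lmodType R[i]) (S : V -> W).
Hypothesis linS : linear S.

Lemma lin0 : S 0 = 0.
Proof. by have := linS (-1) 0 0; rewrite !scaleN1r oppr0 addr0 addNr. Qed.

Lemma linD x y : S (x + y) = S x + S y.
Proof. by have := linS 1 x y; rewrite !scale1r. Qed.

Lemma linZ a x : S (a *: x) = a *: S x.
Proof. by have := linS a x 0; rewrite !addr0 lin0 addr0. Qed.

Lemma linN x : S (- x) = - S x.
Proof. by rewrite -scaleN1r linZ scaleN1r. Qed.

Lemma linB x y : S (x - y) = S x - S y.
Proof. by rewrite linD linN. Qed.

Lemma lin_sum (I : Type) (s : seq I) (f : I -> V) :
  S (\sum_(k <- s) f k) = \sum_(k <- s) S (f k).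
Proof.
elim: s => [|k s IH]; first by rewrite !big_nil lin0.
by rewrite !big_cons linD IH.
Qed.

End Linear.

Section Dot.
Variables (R : realType) (V : hilbertType R).
Implicit Types (x y z : V) (a : R[i]).

Lemma hdotDl x y z : hdot (x + y) z = hdot x z + hdot y z.
Proof. exact: linearDl. Qed.
Lemma hdotDr x y z : hdot z (x + y) = hdot z x + hdot z y.
Proof. exact: linearDr. Qed.
Lemma hdotZl a x z : hdot (a *: x) z = a * hdot x z.
Proof. by rewrite linearZl_LR. Qed.
Lemma hdotZr a x z : hdot z (a *: x) = conjc a * hdot z x.
Proof. by rewrite linearZr_LR. Qed.
Lemma hdotC x y : hdot x y = conjc (hdot y x).
Proof. by rewrite hermC /= expr0 mul1r. Qed.
Lemma hdot0l x : hdot 0 x = 0.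
Proof. by rewrite -[0](scale0r (0 : V)) hdotZl mul0r. Qed.
Lemma hdot0r x : hdot x 0 = 0.
Proof. by rewrite hdotC hdot0l conjc0. Qed.
Lemma hdotNl x z : hdot (- x) z = - hdot x z.
Proof. by rewrite -scaleN1r hdotZl mulN1r. Qed.
Lemma hdotNr x z : hdot z (- x) = - hdot z x.
Proof. by rewrite hdotC hdotNl rmorphN /= [in RHS]hdotC. Qed.
Lemma hdotBl x y z : hdot (x - y) z = hdot x z - hdot y z.
Proof. by rewrite hdotDl hdotNl. Qed.
Lemma hdotBr x y z : hdot z (x - y) = hdot z x - hdot z y.
Proof. by rewrite hdotDr hdotNr. Qed.
Lemma hdot_suml (I : Type) (s : seq I) (f : I -> V) z :
  hdot (\sum_(k <- s) f k) z = \sum_(k <- s) hdot (f k) z.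
Proof.
elim: s => [|k s IH]; first by rewrite !big_nil hdot0l.
by rewrite !big_cons hdotDl IH.
Qed.
Lemma hdot_sumr (I : Type) (s : seq I) (f : I -> V) z :
  hdot z (\sum_(k <- s) f k) = \sum_(k <- s) hdot z (f k).
Proof.
elim: s => [|k s IH]; first by rewrite !big_nil hdot0r.
by rewrite !big_cons hdotDr IH.
Qed.

Lemma hdotxx x : hdot x x = (rnorm x ^+ 2)%:C.
Proof. by rewrite hdot_norm rnormE rmorphXn. Qed.

Lemma hdot_CS x y : rnorm (hdot x y) <= rnorm x * rnorm y.
Proof.
rewrite -(@ler_pXn2r _ 2) ?nnegrE ?mulr_ge0 ?rnorm_ge0 // exprMn -lecR.
have -> : (rnorm (hdot x y) ^+ 2)%:C = `|hdot x y| ^+ 2 by rewrite rnormE rmorphXn.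
have -> : (rnorm x ^+ 2 * rnorm y ^+ 2)%:C = hdot x x * hdot y y.
  by rewrite !hdotxx rmorphM.
have [-> | nz_y] := eqVneq y 0.
  by rewrite !hdot0r normr0 mulr0 expr0n.
have py : 0 < rnorm y.
  rewrite lt_neqAle rnorm_ge0 andbT eq_sym; apply: contra nz_y => /eqP h.
  by apply/eqP/rnorm0_eq0; rewrite h.
set a := hdot x y.
pose b := a / (rnorm y ^+ 2)%:C.
have hy : hdot y y != 0 by rewrite hdotxx; apply/eqP => -[/eqP]; rewrite expf_eq0 gt_eqF.
have cb : conjc b = conjc a / hdot y y.
  by rewrite /b conjcM conjc_inv conjc_real hdotxx.
have : 0 <= hdot (x - b *: y) (x - b *: y).
  by rewrite hdotxx ler0c exprn_ge0 // rnorm_ge0.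
rewrite hdotBl !hdotBr !hdotZl !hdotZr.
have -> : hdot y x = conjc a by rewrite hdotC.
have -> : hdot x y = a by [].
have -> : b * (conjc b * hdot y y) = b * conjc a.
  by rewrite cb divfK.
rewrite subrr subr0 => h0.
have h1 : `|a| ^+ 2 = a * conjc a by rewrite sqr_normc.
have h2 : conjc b * a = `|a| ^+ 2 / hdot y y.
  by rewrite cb h1 mulrAC [a * _]mulrC.
rewrite h2 subr_ge0 in h0.
rewrite -ler_pdivrMr //.
by rewrite lt_neqAle eq_sym hy hdotxx ler0c exprn_ge0 // rnorm_ge0.
Qed.

Lemma hdot_ext x y : (forall z, hdot x z = hdot y z) -> x = y.
Proof.
move=> h; apply/eqP; rewrite -subr_eq0; apply/eqP/rnorm0_eq0.
have : hdot (x - y) (x - y) = 0 by rewrite hdotBl h subrr.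
rewrite hdotxx => -[/eqP]; rewrite expf_eq0 /= => /eqP -> //.
Qed.

End Dot.

(** * Density, completeness and extension of operators *)

Section Topology.
Variables (R : realType).

Lemma dense_approx (V : normedModType R[i]) (D : set V) : dense D ->
  forall y (e : R), 0 < e -> exists2 x, D x & rnorm (y - x) < e.
Proof.
move=> dD y e e0.
have e0' : 0 < e%:C by rewrite ltcR.
have [x [hx Dx]] : (ball y e%:C)^° `&` D !=set0.
  apply: dD; last exact: open_interior.
  by exists y; apply: nbhsx_ballx.
exists x => //.
have := interior_subset hx.
by rewrite -ball_normE /= rnormE ltcR.
Qed.

Lemma closure_pairP (V W : normedModType R[i]) (G : set (V * W)) a b :
  closure G (a, b) <->
  forall e : R, 0 < e -> exists2 p, G p & rnorm (p.1 - a) < e /\ rnorm (p.2 - b) < e.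
Proof.
split=> [h e e0|h B].
  have e0' : 0 < e%:C by rewrite ltcR.
  have [p [Gp]] := h _ (nbhsx_ballx (a, b) _ e0').
  rewrite /ball /= /prod_ball /= -!ball_normE /= => -[h1 h2].
  exists p => //; rewrite (rnorm_distC p.1) (rnorm_distC p.2).
  by move: h1 h2; rewrite !rnormE !ltcR.
move=> /nbhs_ballP[e /= e0 he].
have [r r0 er] : exists2 r : R, 0 < r & e = r%:C.
  exists (complex.Re e); last by rewrite RRe_real // gtr0_real.
  by rewrite -ltcR RRe_real // gtr0_real.
have [p Gp [h1 h2]] := h r r0; exists p; split => //; apply: he.
rewrite /ball /= /prod_ball /= -!ball_normE /= er; split; rewrite /= rnormE ltcR.
  by rewrite rnorm_distC.
by rewrite rnorm_distC.
Qed.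

Lemma bounded_opP (V W : hilbertType R) (S : V -> W) :
  bounded_op S <->
  linear S /\ exists2 C : R, 0 <= C & forall x, rnorm (S x) <= C * rnorm x.
Proof.
split=> [[linS cS]|[linS [C C0 hC]]].
  split => //.
  pose Sl := GRing.isLinear.Build R[i] V W *:%R S linS.
  pose f : {linear V -> W} := HB.pack S Sl.
  have /linear_bounded_continuous/linear_boundedP : continuous f by [].
  move=> /pinfty_ex_gt0[M M0 hM].
  exists (complex.Re M).
    by rewrite -ler0c RRe_real ?ltW // gtr0_real.
  move=> x; have := hM x.
  by rewrite !rnormE -[M]RRe_real ?gtr0_real // -rmorphM lecR.
split => //.
pose Sl := GRing.isLinear.Build R[i] V W *:%R S linS.
pose f : {linear V -> W} := HB.pack S Sl.
suff : continuous f by [].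
apply/linear_bounded_continuous/linear_boundedP.
near=> r => x.
apply: (@le_trans _ _ (C%:C * `|x|)).
  by rewrite !rnormE -rmorphM lecR hC.
rewrite ler_wpM2r //; near: r; apply: nbhs_pinfty_ge.
by rewrite ger0_real // ler0c.
Unshelve. all: by end_near. Qed.

Lemma half_pow_small (M e : R) : 0 < e -> exists N, forall n, (N <= n)%N -> M * 2^-1 ^+ n < e.
Proof.
move=> e0; pose N := (Num.truncn (`|M| / e)).+1.
have NP : `|M| / e < N%:R by rewrite truncnS_gt.
have pw n : n%:R <= 2 ^+ n :> R.
  by rewrite -natrX ler_nat ltnW // ltn_expl.
exists N => n Nn; apply: (@le_lt_trans _ _ (`|M| * 2^-1 ^+ n)).
  by rewrite ler_wpM2r ?ler_norm // exprn_ge0 // invr_ge0.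
rewrite exprVn ltr_pdivrMr ?exprn_gt0 // mulrC -ltr_pdivrMr //.
apply: lt_le_trans NP _; apply: le_trans (pw n); by rewrite ler_nat.
Qed.

(** Completeness in quantitative form. The rate is used too: at n = 0 it bounds the limit, and it
    makes limits of operators uniform. *)
Lemma cauchy_geometric (V : hilbertType R) (u : nat -> V) (M : R) :
  (forall n, rnorm (u n.+1 - u n) <= M * 2^-1 ^+ n) ->
  exists l, forall n, rnorm (u n - l) <= 2 * M * 2^-1 ^+ n.
Proof.
move=> hu.
have tail n k : rnorm (u (n + k)%N - u n) <= 2 * M * 2^-1 ^+ n - 2 * M * 2^-1 ^+ (n + k).
  elim: k => [|k IH]; first by rewrite addn0 !subrr rnorm0.
  apply: (le_trans (rnorm_distD _ (u (n + k)%N) _)); rewrite addnS.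
  apply: (le_trans (lerD (hu _) IH)).
  by rewrite exprS; lra.
have M0 : 0 <= M.
  by have := hu 0%N; rewrite expr0 mulr1; apply: le_trans; rewrite rnorm_ge0.
have pow_ge0 n : 0 <= 2^-1 ^+ n :> R by rewrite exprn_ge0 // invr_ge0.
have tail' n m : (n <= m)%N -> rnorm (u m - u n) <= 2 * M * 2^-1 ^+ n.
  move=> nm; rewrite -(subnKC nm); apply: (le_trans (tail _ _)).
  by rewrite gerDl oppr_le0 !mulr_ge0.
have cu : cvg (u @ \oo).
  apply/cauchy_cvgP/cauchy_exP => e e0.
  have [r r0 er] : exists2 r : R, 0 < r & e = r%:C.
    exists (complex.Re e); last by rewrite RRe_real // gtr0_real.
    by rewrite -ltcR RRe_real // gtr0_real.
  have [N hN] := half_pow_small (2 * M) r0.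
  exists (u N); exists N => // m /= Nm.
  rewrite -ball_normE /= rnormE er ltcR rnorm_distC.
  by apply: (le_lt_trans (tail' _ _ Nm)); exact: hN.
exists (lim (u @ \oo)) => n.
rewrite -subr_le0; apply: (@le0_small _ _ 1) => e e0; rewrite mul1r lerBlDr.
have e0' : 0 < e%:C by rewrite ltcR.
have /cvgrPdist_lt /(_ _ e0') [N _ hN] := cu.
have := hN (maxn N n) (leq_maxl _ _); rewrite /= rnormE ltcR => h1.
apply: (le_trans (rnorm_distD _ (u (maxn N n)) _)).
rewrite addrC lerD //; first by rewrite ltW // rnorm_distC.
by rewrite rnorm_distC tail' // leq_maxr.
Qed.

(** The bound makes h u depend on g u only, so h factors through the dense range of g and extends by
    limits. *)
Lemma extend_bounded (U : lmodType R[i]) (V W : hilbertType R)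
    (g : {linear U -> V}) (h : {linear U -> W}) (C : R) :
  dense (range g) -> 0 <= C -> (forall u, rnorm (h u) <= C * rnorm (g u)) ->
  exists S, [/\ linear S, forall x, rnorm (S x) <= C * rnorm x &
                forall u, S (g u) = h u].
Proof.
move=> dg C0 hC.
have /choice[a ha] (x : V) : exists a : nat -> U, forall n, rnorm (x - g (a n)) < 2^-1 ^+ n.
  suff /choice[a ha] n : exists u, rnorm (x - g u) < 2^-1 ^+ n by exists a.
  have [|_ [u _ <-] hu] := dense_approx dg x (e := 2^-1 ^+ n).
    by rewrite exprn_gt0 // invr_gt0.
  by exists u.
have /choice[S hS] (x : V) : exists y, forall n, rnorm (h (a x n) - y) <= 2 * (2 * C) * 2^-1 ^+ n.
  apply: cauchy_geometric => n.
  rewrite -linearB; apply: (le_trans (hC _)).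
  have -> : 2 * C * 2^-1 ^+ n = C * (2 * 2^-1 ^+ n) by rewrite mulrCA mulrA.
  rewrite ler_wpM2l // linearB.
  apply: (le_trans (rnorm_distD _ x _)).
  rewrite mulr2n mulrDl mul1r lerD //; last by rewrite ltW // ha.
  rewrite rnorm_distC ltW //; apply: (lt_le_trans (ha _ _)).
  by rewrite exprS ler_piMl ?exprn_ge0 ?invr_ge0 // invf_le1 // ler1n.
(* This estimate characterizes S x as the limit of h along any approximation of x; the values on the
   range, the bound and linearity are all read off from it. *)
have key x u : rnorm (h u - S x) <= C * rnorm (g u - x).
  rewrite -subr_le0; apply: (@le0_small _ _ (C + 2 * (2 * C))) => e e0.
  have [N hN] := half_pow_small 1 e0.
  have {hN}hN := ltW (hN N (leqnn _)); rewrite mul1r in hN.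
  rewrite lerBlDr.
  apply: (le_trans (rnorm_distD _ (h (a x N)) _)).
  have h2 : rnorm (h (a x N) - S x) <= 2 * (2 * C) * e.
    by apply: (le_trans (hS _ _)); rewrite ler_wpM2l // !mulr_ge0.
  have h1 : rnorm (h u - h (a x N)) <= C * (rnorm (g u - x) + e).
    rewrite -linearB; apply: (le_trans (hC _)); rewrite ler_wpM2l // linearB.
    apply: (le_trans (rnorm_distD _ x _)); rewrite lerD2l.
    by rewrite ltW // (lt_le_trans (ha x N)).
  by apply: (le_trans (lerD h1 h2)); lra.
have Sg u : S (g u) = h u.
  apply/eqP; rewrite eq_sym -subr_eq0; apply/eqP/rnorm0_eq0.
  by apply: (le_trans (key _ _)); rewrite subrr rnorm0 mulr0.
exists S; split => //; last first.
  by move=> x; have := key x 0; rewrite !linear0 !sub0r !rnormN.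
move=> b x y; apply/eqP; rewrite -subr_eq0; apply/eqP/rnorm0_eq0.
apply: (@le0_small _ _ (2 * C * (rnorm b + 1))) => e e0.
have [_ [u _ <-] hu] := dense_approx dg x e0.
have [_ [v _ <-] hv] := dense_approx dg y e0.
have hu' := key x u; have hv' := key y v.
have hw := key (b *: x + y) (b *: u + v).
rewrite (linearP h) (linearP g) in hw.
have -> : S (b *: x + y) - (b *: S x + S y) =
   b *: (h u - S x) + (h v - S y) - (b *: h u + h v - S (b *: x + y)).
  rewrite scalerBr opprB [X in _ = X + _]addrACA -opprD [in RHS]addrC.
  by rewrite -addrA [X in _ = _ + X]addrC subrK addrC.
apply: (le_trans (rnormB _ _)).
apply: (le_trans (lerD (rnormD _ _) hw)); rewrite rnormZ.
have hz : rnorm (b *: g u + g v - (b *: x + y)) <= rnorm b * e + e.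
  have -> : b *: g u + g v - (b *: x + y) = b *: (g u - x) + (g v - y).
    by rewrite scalerBr opprD addrACA.
  apply: (le_trans (rnormD _ _)); rewrite rnormZ.
  by rewrite lerD ?ler_wpM2l ?rnorm_ge0 // rnorm_distC ltW.
have t1 : rnorm b * rnorm (h u - S x) <= rnorm b * (C * e).
  rewrite ler_wpM2l ?rnorm_ge0 //; apply: (le_trans hu').
  by rewrite ler_wpM2l // rnorm_distC ltW.
have t2 : rnorm (h v - S y) <= C * e.
  by apply: (le_trans hv'); rewrite ler_wpM2l // rnorm_distC ltW.
have t3 : C * rnorm (b *: g u + g v - (b *: x + y)) <= C * (rnorm b * e + e).
  by rewrite ler_wpM2l.
by apply: (le_trans (lerD (lerD t1 t2) t3)); lra.
Qed.

End Topology.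

Lemma expr_small (R : realType) (t rho : R) : 0 <= t -> t < 1 ->
  exists N, forall n, (N <= n)%N -> rho * t ^+ n <= 1.
Proof.
move=> t0 t1.
have h : (fun n => t ^+ n) @ \oo --> (0 : R).
  by apply: cvg_expr; rewrite ger0_norm.
have e0 : 0 < (`|rho| + 1)^-1 by rewrite invr_gt0 ltr_wpDl.
have /cvgrPdist_lt/(_ _ e0) [N _ hN] := h.
exists N => n /hN; rewrite /= sub0r normrN ger0_norm ?exprn_ge0 // => hn.
apply: (@le_trans _ _ ((`|rho| + 1) * t ^+ n)).
  by rewrite ler_wpM2r ?exprn_ge0 // (le_trans (ler_norm rho)) // lerDl.
by rewrite mulrC -ler_pdivlMr ?ltr_wpDl // mul1r ltW.
Qed.

(** * The q-deformed inner product on words *)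

Lemma inversionsE n (s : 'S_n) :
  inversions s = (\sum_(a < n) \sum_(b < n) ((a < b) && (s b < s a)))%N.
Proof.
rewrite /inversions -sum1_card big_mkcond /= pair_bigA /=.
by apply: eq_bigr => p _; rewrite unfold_in /= /in_set asboolb; case: (_ && _).
Qed.

Lemma ltn_lift n (k : 'I_n.+1) (a b : 'I_n) : (lift k a < lift k b)%N = (a < b)%N.
Proof. by rewrite !ltnNge leq_bump2. Qed.

(** Sending the first position to k creates one inversion with each of the k later positions whose
    value lies below k; all other pairs are compared as in s. *)
Lemma inversions_lift n (k : 'I_n.+1) (s : 'S_n) :
  inversions (lift_perm ord0 k s) = (k + inversions s)%N.
Proof.
rewrite !inversionsE big_ord_recl [X in (X + _)%N]big_ord_recl /= add0n; congr addn.
  rewrite (eq_bigr (fun b : 'I_n => (lift k (s b) < k)%N : nat)) => [|b _]; last first.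
    by rewrite lift_perm_id lift_perm_lift.
  rewrite -(reindex_inj (@perm_inj _ s) (P := xpredT)
    (F := fun b : 'I_n => (lift k b < k)%N : nat)) /=.
  rewrite (eq_bigr (fun b : 'I_n => (b < k)%N : nat)) => [|b _]; last first.
    by rewrite /= /bump; case: (leqP k b) => kb /=; lia.
  rewrite -big_mkcond /= -(big_ord_widen n (fun=> 1%N)) ?sum1_card ?card_ord //.
  by rewrite -ltnS.
apply: eq_bigr => a _; rewrite big_ord_recl /= add0n; apply: eq_bigr => b _.
by rewrite !lift_perm_lift ltn_lift /bump /= !add1n ltnS.
Qed.

Section Perm.
Variables (R : realType) (d : nat) (q : R).
Implicit Types (i : 'I_d) (u v w : seq 'I_d).

Definition permdot n u (t : n.-tuple 'I_d) : R :=
  \sum_(s : 'S_n) q ^+ inversions s * (u == [seq tnth t (s k) | k <- enum 'I_n])%:R.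

Definition qdot u v : R := permdot u (in_tuple v).

Lemma permdotS n i u (t : n.+1.-tuple 'I_d) :
  permdot (i :: u) t =
  \sum_(k < n.+1) (tnth t k == i)%:R * q ^+ k * permdot u [tuple tnth t (lift k j) | j < n].
Proof.
rewrite /permdot (partition_big (fun s : 'S_n.+1 => s ord0) xpredT) //=.
apply: eq_bigr => k _.
rewrite (reindex (lift_perm ord0 k)) /=; last first.
  (* f s is s without its first value; the default [j] is never reached, since s is injective. *)
  pose f (s : 'S_n.+1) (j : 'I_n) := odflt j (unlift (s ord0) (s (lift ord0 j))).
  have fK (s : 'S_n.+1) (j : 'I_n) : lift (s ord0) (f s j) = s (lift ord0 j).
    rewrite /f; case: unliftP => [m -> //|/perm_inj e].
    by have := neq_lift ord0 j; rewrite e eqxx.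
  have f_inj s : injective (f s).
    by move=> a b e; apply/(@lift_inj _ ord0)/(@perm_inj _ s); rewrite -!fK e.
  exists (fun s => perm (f_inj s)) => [s _|s /eqP sk]; apply/permP => j.
    by rewrite permE; apply: (@lift_inj _ k); rewrite -{1}(lift_perm_id ord0 k s) fK lift_perm_lift.
  by case: (unliftP ord0 j) => [m|] ->; rewrite ?lift_perm_id // lift_perm_lift permE -sk fK.
rewrite mulr_sumr.
rewrite (eq_bigl xpredT) => [|s]; last by rewrite lift_perm_id eqxx.
apply: eq_bigr => s _; rewrite inversions_lift exprD enum_ordSl /= lift_perm_id.
rewrite eqseq_cons -mulnb natrM eq_sym -map_comp.
have -> : [seq ([eta tnth t] \o [eta lift_perm ord0 k s]) (lift ord0 j) | j <- enum 'I_n] =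
   [seq tnth [tuple tnth t (lift k j) | j < n] (s k0) | k0 <- enum 'I_n].
  by apply: eq_map => j /=; rewrite lift_perm_lift tnth_mktuple.
by set X : R := (u == _)%:R; set Y : R := (_ == i)%:R; ring.
Qed.

Lemma permdot_val n m u (t : n.-tuple 'I_d) (t' : m.-tuple 'I_d) :
  t = t' :> seq 'I_d -> permdot u t = permdot u t'.
Proof.
move=> tt'; have nm : n = m by rewrite -(size_tuple t) tt' size_tuple.
by subst m; congr permdot; apply: val_inj.
Qed.

(** The terms of l_i e_w: each occurrence of i in w is deleted with weight q to the number of
    letters before it. The recursion is l_i L_a = delta_ia + q L_a l_i on words. *)
Fixpoint dels i w : seq (R * seq 'I_d) :=
  if w is a :: w' then
    (if a == i then [:: (1, w')] else [::]) ++ [seq (q * p.1, a :: p.2) | p <- dels i w']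
  else [::].

Lemma dels_sumE i w (f : seq 'I_d -> R) :
  \sum_(p <- dels i w) p.1 * f p.2 =
  \sum_(k < size w) (nth i w k == i)%:R * q ^+ k * f (take k w ++ drop k.+1 w).
Proof.
elim: w f => [|a w IH] f /=; first by rewrite big_nil big_ord0.
rewrite big_cat big_ord_recl /= drop0 big_map /=; congr (_ + _).
  by case: (a == i); rewrite ?big_seq1 ?big_nil ?mul0r //= expr0 mulr1.
have := IH (fun v => q * f (a :: v)).
rewrite (eq_bigr (fun p => q * p.1 * f (a :: p.2))) => [->|p _]; last first.
  by rewrite mulrCA mulrA.
by apply: eq_bigr => k _; rewrite /bump /= add1n exprS; ring.
Qed.

Lemma dels_size i w p : p \in dels i w -> size w = (size p.2).+1.
Proof.
elim: w p => [|a w IH] p //=; rewrite mem_cat => /orP[|/mapP[p' /IH -> ->] //].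
by case: (a == i) => //; rewrite inE => /eqP ->.
Qed.

Lemma qdot_nil v : qdot [::] v = (v == [::])%:R.
Proof.
rewrite /qdot /permdot; case: v => [|a v].
  rewrite (big_pred1 1%g) => [|s]; last first.
    by apply/esym/eqP/permP => -[].
  rewrite inversionsE big_ord0 expr0 mul1r.
  by case: (enum _) => // -[].
by rewrite big1 // => s _; rewrite enum_ordSl /= mulr0.
Qed.

(** Adjointness of creation and deletion at the level of words: [dels] lists the positions of v that
    i can be matched with, weighted by the inversions they cause. *)
Lemma qdot_cons i u v : qdot (i :: u) v = \sum_(p <- dels i v) p.1 * qdot u p.2.
Proof.
rewrite dels_sumE {1}/qdot; case: v => [|a v].
  rewrite big_ord0 /permdot big1 // => s _.
  have -> : enum 'I_0 = [::] by apply: size0nil; rewrite size_enum_ord.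
  by rewrite mulr0.
rewrite permdotS; apply: eq_bigr => k _; rewrite (tnth_nth i) /=; congr (_ * _).
rewrite /qdot /permdot /=.
set w := _ ++ _.
have tw : tval [tuple tnth (in_tuple (a :: v)) (lift k j) | j < size v] = w.
  apply: (@eq_from_nth _ i) => [|j].
    have kv : (k <= size v)%N := ltn_ord k.
    by rewrite size_tuple /w size_cat size_drop size_takel ?subSS ?subnKC // (leq_trans kv).
  rewrite size_tuple => jv; rewrite -[j]/(val (Ordinal jv)) -tnth_nth tnth_mktuple.
  rewrite (tnth_nth i) /w nth_cat size_takel; last by rewrite /= ltnW // ltn_ord.
  rewrite /= /bump; case: (leqP k j) => kj; last by rewrite nth_take.
  by rewrite nth_drop subnKC.
exact: permdot_val.
Qed.

(** Conjugating a permutation by the reversal flips the order in both source and target, hence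
    preserves inversions. *)
Lemma permdot_rev n u (t : n.-tuple 'I_d) :
  permdot (rev u) [tuple of rev t] = permdot u t.
Proof.
pose r : 'S_n := perm (@rev_ord_inj n).
have rE k : r k = rev_ord k by rewrite permE.
have rr : (r * r = 1)%g by apply/permP => k; rewrite permM !rE rev_ordK perm1.
rewrite /permdot (reindex (fun s : 'S_n => (r * s * r)%g)) /=; last first.
  exists (fun s : 'S_n => (r * s * r)%g) => s _.
    by rewrite !mulgA rr mul1g -mulgA rr mulg1.
  by rewrite !mulgA rr mul1g -mulgA rr mulg1.
apply: eq_bigr => s _; congr (_ ^+ _ * _).
  rewrite !inversionsE exchange_big /= (reindex_inj rev_ord_inj) /=.
  apply: eq_bigr => a _; rewrite (reindex_inj rev_ord_inj) /=; apply: eq_bigr => b _.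
  rewrite !permM !rE !rev_ordK /=.
  have := ltn_ord a; have := ltn_ord b; have := ltn_ord (s a); have := ltn_ord (s b).
  by move=> ? ? ? ?; congr (nat_of_bool (_ && _)); lia.
rewrite -[in RHS](inj_eq (can_inj revK)) -map_rev.
congr (_ == _)%:R.
have -> : rev (enum 'I_n) = map (@rev_ord n) (enum 'I_n).
  apply: (inj_map val_inj); rewrite map_rev val_enum_ord -map_comp.
  apply: (@eq_from_nth _ 0%N);
    rewrite size_rev size_iota ?size_map -?enumT ?size_enum_ord // => k kn.
  rewrite nth_rev ?size_iota // (nth_map (Ordinal kn)) ?size_enum_ord //=.
  by rewrite nth_iota ?nth_enum_ord //; lia.
rewrite -map_comp; apply: eq_map => k /=.
rewrite !permM !rE (tnth_nth (tnth t k)) [RHS](tnth_nth (tnth t k)) /=.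
have := ltn_ord (s (rev_ord k)); move: (nat_of_ord _) => m mn.
rewrite (nth_rev _ (s := tval t)) size_tuple; last by lia.
by congr (nth _ _ _); lia.
Qed.

Lemma qdot_rev u v : qdot (rev u) (rev v) = qdot u v.
Proof.
rewrite [RHS]/qdot -(permdot_rev u (in_tuple v)) /qdot.
exact: permdot_val.
Qed.

Lemma qdot_size u v : size u != size v -> qdot u v = 0.
Proof.
move=> uv; rewrite /qdot /permdot big1 // => s _; case: eqP => [e|]; last by rewrite mulr0.
by move: uv; rewrite e size_map size_enum_ord eqxx.
Qed.

End Perm.

Lemma fock_qdotE (R : realType) d (q : R) (u v : seq 'I_d) :
  fock_qdot q (fock_basis R (FMonom u)) (fock_basis R (FMonom v)) = (qdot q u v)%:C.
Proof.
rewrite /fock_qdot /q_symmetrizer /fock_basis mlin_basis /fock_dot.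
rewrite msuppU oner_eq0 big_seq_fset1 mcoeffUU mul1r.
rewrite raddf_sum /= rmorph_sum /= /qdot /permdot [RHS]rmorph_sum /=.
apply: eq_bigr => s _.
rewrite mcoeffZ mcoeffU -[(_ * _)^*%R]/(conjc _) eq_sym.
have -> : (FMonom u == @perm_word d (FMonom v) s) =
          (u == [seq tnth (in_tuple v) (s k) | k <- enum 'I_(size v)]) by [].
set b := (u == _); have -> : (q ^+ inversions s)%:C * b%:R = (q ^+ inversions s * b%:R)%:C.
  by rewrite [RHS]rmorphM rmorph_nat.
exact: conjc_real.
Qed.

(** * Bounded operators *)

Section BoundedOps.
Variables (R : realType).
Implicit Types (U V W : hilbertType R).

Lemma bounded_op_lin V W (S : V -> W) : bounded_op S -> linear S.
Proof. by case. Qed.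

Lemma bounded_op_comp U V W (S : V -> W) (S' : U -> V) :
  bounded_op S -> bounded_op S' -> bounded_op (fun x => S (S' x)).
Proof.
move=> [l1 c1] [l2 c2]; split; first by move=> a x y; rewrite l2 l1.
by move=> x; apply: (@continuous_comp _ _ _ S' S x); [exact: c2|exact: c1].
Qed.

Lemma bounded_op_comb V W (a : R[i]) (S S' : V -> W) :
  bounded_op S -> bounded_op S' -> bounded_op (fun x => a *: S x + S' x).
Proof.
move=> /bounded_opP[l1 [C C0 h1]] /bounded_opP[l2 [C' C0' h2]].
apply/bounded_opP; split.
  by move=> b x y; rewrite l1 l2 !scalerDr !scalerA [a * b]mulrC addrACA.
exists (rnorm a * C + C'); first by rewrite addr_ge0 ?mulr_ge0 ?rnorm_ge0.
move=> x; apply: (le_trans (rnormD _ _)); rewrite rnormZ mulrDl -mulrA.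
by rewrite lerD // ler_wpM2l ?rnorm_ge0.
Qed.

Lemma bounded_op_id V : bounded_op (fun x : V => x).
Proof. by split=> // x; apply: cvg_id. Qed.

Lemma bounded_op_zero V W : bounded_op (fun _ : V => 0 : W).
Proof.
apply/bounded_opP; split; first by move=> a x y; rewrite scaler0 addr0.
by exists 0 => // x; rewrite rnorm0 mul0r.
Qed.

Lemma bounded_opZ V W a (S : V -> W) :
  bounded_op S -> bounded_op (fun x => a *: S x).
Proof.
move=> h; rewrite (_ : (fun x => _) = (fun x => a *: S x + 0)).
  exact: bounded_op_comb (bounded_op_zero _ _).
by apply/funext => x; rewrite addr0.
Qed.

Lemma bounded_opD V W (S S' : V -> W) :
  bounded_op S -> bounded_op S' -> bounded_op (fun x => S x + S' x).
Proof.
move=> h h'; rewrite (_ : (fun x => _) = (fun x => 1 *: S x + S' x)).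
  exact: bounded_op_comb.
by apply/funext => x; rewrite scale1r.
Qed.

Lemma bounded_opB V W (S S' : V -> W) :
  bounded_op S -> bounded_op S' -> bounded_op (fun x => S x - S' x).
Proof.
move=> h h'; rewrite (_ : (fun x => _) = (fun x => (-1) *: S' x + S x)).
  exact: bounded_op_comb.
by apply/funext => x; rewrite scaleN1r addrC.
Qed.

Lemma bounded_op_eq_dense V W (D : set V) (f g : V -> W) :
  dense D -> bounded_op f -> bounded_op g -> (forall x, D x -> f x = g x) -> f =1 g.
Proof.
move=> dD bf bg fg x; apply/eqP; rewrite -subr_eq0; apply/eqP/rnorm0_eq0.
have /bounded_opP[lin [C C0 hC]] := bounded_opB bf bg.
apply: (@le0_small _ _ C) => e e0; have [y Dy xy] := dense_approx dD x e0.
have -> : f x - g x = f (x - y) - g (x - y).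
  by rewrite (linB lin) (fg y Dy) subrr subr0.
by apply: (le_trans (hC _)); rewrite ler_wpM2l // ltW.
Qed.

Lemma dense_sep V (D : set V) x y :
  dense D -> (forall z, D z -> hdot x z = hdot y z) -> x = y.
Proof.
move=> dD h; apply/eqP; rewrite -subr_eq0; apply/eqP/rnorm0_eq0.
set u := x - y; have hu z : D z -> hdot u z = 0 by move=> /h e; rewrite hdotBl e subrr.
apply: (@le0_small _ _ 1) => e e0; rewrite mul1r leNgt; apply/negP => eu.
have [z Dz uz] := dense_approx dD u e0.
have u0 : 0 < rnorm u by exact: lt_trans eu.
have : rnorm (hdot u u) <= rnorm u * rnorm (u - z).
  by rewrite -[hdot u u]subr0 -(hu z Dz) -hdotBr hdot_CS.
rewrite hdotxx rnorm_real ger0_norm ?exprn_ge0 ?rnorm_ge0 // expr2 ler_pM2l //.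
by rewrite leNgt (lt_trans uz eu).
Qed.

Lemma hdot_mlin (K L : choiceType) V (f : K -> V) (g : L -> V) x y :
  hdot (mlin f x) (mlin g y) =
  \sum_(k <- msupp x) \sum_(l <- msupp y)
    mcoeff k x * conjc (mcoeff l y) * hdot (f k) (g l).
Proof.
rewrite hdot_suml; apply: eq_bigr => k _; rewrite hdot_sumr; apply: eq_bigr => l _.
by rewrite hdotZl hdotZr mulrA.
Qed.

Lemma mlin_ext (K : choiceType) (V W : lmodType R[i]) (f g : V -> W) (e : K -> V) x :
  linear f -> linear g -> (forall k, f (e k) = g (e k)) -> f (mlin e x) = g (mlin e x).
Proof.
move=> lf lg fg; rewrite (lin_sum lf) (lin_sum lg); apply: eq_bigr => k _.
by rewrite (linZ lf) (linZ lg) fg.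
Qed.

Section Span.
Variables (K : choiceType) (V : hilbertType R) (e : K -> V).
Hypothesis dense_e : dense (range (mlin e)).

Lemma span_ext (W : hilbertType R) (f g : V -> W) :
  bounded_op f -> bounded_op g -> (forall k, f (e k) = g (e k)) -> f =1 g.
Proof.
move=> bf bg fg; apply: (bounded_op_eq_dense dense_e bf bg) => _ [x _ <-].
by apply: mlin_ext fg; exact: bounded_op_lin.
Qed.

Lemma span_sep x y : (forall k, hdot x (e k) = hdot y (e k)) -> x = y.
Proof.
move=> h; apply: dense_sep dense_e _ => _ [z _ <-].
by rewrite !hdot_sumr; apply: eq_bigr => w _; rewrite !hdotZr h.
Qed.

Lemma span_adjoint (f g : V -> V) : bounded_op f -> bounded_op g ->
  (forall k m, hdot (f (e k)) (e m) = hdot (e k) (g (e m))) -> adjoint f g.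
Proof.
move=> bf bg h x y.
have hv v z : hdot (f z) (e v) = hdot z (g (e v)).
  apply/eqP; rewrite -subr_eq0; apply/eqP/rnorm0_eq0.
  have /bounded_opP[lf [C C0 hC]] := bf.
  apply: (@le0_small _ _ (C * rnorm (e v) + rnorm (g (e v)))) => ep ep0.
  have [_ [t _ <-] zt] := dense_approx dense_e z ep0.
  have ht : hdot (f (mlin e t)) (e v) = hdot (mlin e t) (g (e v)).
    rewrite (lin_sum lf) !hdot_suml; apply: eq_bigr => w _.
    by rewrite (linZ lf) !hdotZl h.
  have -> : hdot (f z) (e v) - hdot z (g (e v)) =
            hdot (f (z - mlin e t)) (e v) - hdot (z - mlin e t) (g (e v)).
    by rewrite (linB lf) !hdotBl ht opprB addrA subrK.
  apply: (le_trans (rnormB _ _)); apply: (le_trans (lerD (hdot_CS _ _) (hdot_CS _ _))).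
  rewrite mulrDl lerD //.
    rewrite mulrAC ler_wpM2r ?rnorm_ge0 //; apply: (le_trans (hC _)).
    by rewrite ler_wpM2l // ltW.
  by rewrite mulrC ler_wpM2l ?rnorm_ge0 // ltW.
apply/eqP; rewrite -subr_eq0; apply/eqP/rnorm0_eq0.
have /bounded_opP[lg [C C0 hC]] := bg.
apply: (@le0_small _ _ (rnorm (f x) + rnorm x * C)) => ep ep0.
have [_ [t _ <-] yt] := dense_approx dense_e y ep0.
have ht : hdot (f x) (mlin e t) = hdot x (g (mlin e t)).
  rewrite (lin_sum lg) !hdot_sumr; apply: eq_bigr => w _.
  by rewrite (linZ lg) !hdotZr hv.
have -> : hdot (f x) y - hdot x (g y) =
          hdot (f x) (y - mlin e t) - hdot x (g (y - mlin e t)).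
  by rewrite (linB lg) !hdotBr ht opprB addrA subrK.
apply: (le_trans (rnormB _ _)); apply: (le_trans (lerD (hdot_CS _ _) (hdot_CS _ _))).
rewrite mulrDl lerD //; first by rewrite ler_wpM2l ?rnorm_ge0 // ltW.
rewrite -mulrA ler_wpM2l ?rnorm_ge0 //; apply: (le_trans (hC _)).
by rewrite ler_wpM2l // ltW.
Qed.

End Span.

Lemma adjoint_sym V W (S : V -> W) (S' : W -> V) : adjoint S S' -> adjoint S' S.
Proof. by move=> h x y; rewrite hdotC -h -hdotC. Qed.

End BoundedOps.

(** * Creation and annihilation operators *)

Section Fock.
Variables (R : realType) (d : nat) (q : R) (F : hilbertType R).
Variable iota : {linear fock_alg R d -> F}.
Variables l L : 'I_d -> F -> F.
Hypothesis d_gt0 : (0 < d)%N.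
Hypothesis q_fock : q_fock_space q iota.
Hypothesis bL : forall i, bounded_op (L i).
Hypothesis L_basis : forall i w,
  L i (iota (fock_basis R w)) = iota (fock_basis R (mmul (fmu i) w)).
Hypothesis bl : forall i, bounded_op (l i).
Hypothesis adj_Ll : forall i, adjoint (L i) (l i).
Implicit Types (i j a : 'I_d) (u v w : seq 'I_d) (x y : F).

Definition word_vec w : F := iota (fock_basis R (FMonom w)).

Let linL i : linear (L i) := bounded_op_lin (bL i).

Lemma adj_lL i : adjoint (l i) (L i).
Proof. exact: adjoint_sym. Qed.

Lemma L_word i w : L i (word_vec w) = word_vec (i :: w).
Proof.
rewrite /word_vec L_basis; congr (iota (fock_basis _ _)).
by apply/eqP; rewrite fmP fmM fmU.
Qed.

Lemma hdot_word u v : hdot (word_vec u) (word_vec v) = (qdot q u v)%:C.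
Proof. by rewrite /word_vec q_fock.1 fock_qdotE. Qed.

Lemma iota_mlin (x : fock_alg R d) : iota x = mlin (fun w : fmonom _ => iota (fock_basis R w)) x.
Proof.
elim/malg_basis_ind: x => [|k|a x y IH IH']; first by rewrite !linear0.
  by rewrite mlin_basis.
by rewrite !linearP IH IH'.
Qed.

Let e (w : fmonom 'I_d) : F := word_vec w.

Lemma word_dense : dense (range (mlin e)).
Proof.
suff -> : range (mlin e) = range iota by exact: q_fock.2.
by apply/seteqP; split=> _ [x _ <-]; exists x => //; rewrite iota_mlin; apply: eq_bigr => -[].
Qed.

Lemma word_ext (W : hilbertType R) (f g : F -> W) :
  bounded_op f -> bounded_op g -> (forall w, f (word_vec w) = g (word_vec w)) -> f =1 g.
Proof. by move=> bf bg fg; apply: (span_ext word_dense bf bg) => k; exact: fg. Qed.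

Lemma word_sep x y : (forall w, hdot x (word_vec w) = hdot y (word_vec w)) -> x = y.
Proof. by move=> h; apply: (span_sep word_dense) => k; exact: h. Qed.

Lemma l_word i v : l i (word_vec v) = \sum_(p <- dels q i v) p.1%:C *: word_vec p.2.
Proof.
apply: word_sep => u; rewrite hdotC -adj_Ll L_word hdot_word qdot_cons conjc_real.
rewrite rmorph_sum /= hdot_suml; apply: eq_bigr => p _.
by rewrite hdotZl hdotC hdot_word conjc_real rmorphM.
Qed.

Lemma l_L i a x : l i (L a x) = (i == a)%:R *: x + q%:C *: L a (l i x).
Proof.
apply: (word_ext (f := fun x => l i (L a x))
  (g := fun x => (i == a)%:R *: x + q%:C *: L a (l i x))) => [||w].
- exact: bounded_op_comp.
- apply: bounded_opD; first exact: bounded_opZ (bounded_op_id _).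
  exact/bounded_opZ/bounded_op_comp.
rewrite L_word !l_word /= big_cat /=; congr (_ + _).
  by rewrite eq_sym; case: eqP; rewrite ?big_nil ?big_seq1 ?scale0r ?scale1r.
rewrite big_map (lin_sum (@linL a)) scaler_sumr; apply: eq_bigr => p _ /=.
by rewrite (linZ (@linL a)) L_word scalerA rmorphM.
Qed.

Lemma l_vacuum i : l i (word_vec [::]) = 0.
Proof. by rewrite l_word big_nil. Qed.

(** Reversing words preserves the q-inner product, so it extends to an isometry. Conjugation by it
    turns the left operators into the right ones, together with their bounds and adjoints. *)
Lemma flip_exists : exists W : F -> F,
  [/\ bounded_op W, forall w, W (word_vec w) = word_vec (rev w) &
      forall x, rnorm (W x) <= rnorm x].
Proof.
pose h := mlin (fun w : fmonom 'I_d => word_vec (rev w)) : {linear fock_alg R d -> F}.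
have [|S [linS hS Sh]] := @extend_bounded _ _ _ _ iota h 1 q_fock.2 ler01.
  move=> u; rewrite mul1r -(@ler_pXn2r _ 2) ?nnegrE ?rnorm_ge0 // -lecR -!hdotxx.
  rewrite iota_mlin !hdot_mlin le_eqVlt; apply/orP; left; apply/eqP.
  apply: eq_bigr => k _; apply: eq_bigr => k' _; case: k k' => k [k'].
  by rewrite hdot_word qdot_rev -hdot_word.
exists S; split.
- by apply/bounded_opP; split => //; exists 1.
- by move=> w; rewrite {1}/word_vec Sh /h [LHS]mlin_basis.
- by move=> x; rewrite -[X in _ <= X]mul1r.
Qed.

Definition flip : F -> F := projT1 (cid flip_exists).

Lemma bounded_flip : bounded_op flip.
Proof. by rewrite /flip; case: cid => W []. Qed.

Lemma flip_word w : flip (word_vec w) = word_vec (rev w).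
Proof. by rewrite /flip; case: cid => W []. Qed.

Let linW : linear flip := bounded_op_lin bounded_flip.

Lemma adj_flip : adjoint flip flip.
Proof.
apply: (span_adjoint word_dense) bounded_flip bounded_flip _ => u v; rewrite /e.
by rewrite !flip_word !hdot_word -(qdot_rev _ _ (rev v)) revK.
Qed.

Definition rcre a x := flip (L a (flip x)).
Definition rann a x := flip (l a (flip x)).

Lemma bounded_rcre a : bounded_op (rcre a).
Proof. exact/bounded_op_comp/bounded_op_comp/bounded_flip/bL/bounded_flip. Qed.
Lemma bounded_rann a : bounded_op (rann a).
Proof. exact/bounded_op_comp/bounded_op_comp/bounded_flip/bl/bounded_flip. Qed.
Let linR a : linear (rcre a) := bounded_op_lin (bounded_rcre a).

Lemma rcre_word a w : rcre a (word_vec w) = word_vec (rcons w a).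
Proof. by rewrite /rcre flip_word L_word flip_word rev_cons revK. Qed.

Lemma rann_vacuum a : rann a (word_vec [::]) = 0.
Proof. by rewrite /rann flip_word l_vacuum (lin0 linW). Qed.

Lemma adj_rcre a : adjoint (rcre a) (rann a).
Proof. by move=> x y; rewrite /rcre adj_flip adj_Ll adj_flip. Qed.

Lemma adj_rann a : adjoint (rann a) (rcre a).
Proof. exact/adjoint_sym/adj_rcre. Qed.

Lemma L_rcre i a x : L i (rcre a x) = rcre a (L i x).
Proof.
apply: (word_ext (f := fun x => L i (rcre a x)) (g := fun x => rcre a (L i x))) => [||w].
- exact/bounded_op_comp/bounded_rcre/bL.
- exact/bounded_op_comp/bL/bounded_rcre.
- by rewrite L_word !rcre_word L_word.
Qed.

Lemma l_rann i a x : l i (rann a x) = rann a (l i x).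
Proof.
apply: hdot_ext => z.
by rewrite adj_lL adj_rann adj_rann adj_lL L_rcre.
Qed.

(** This is q^N, written as a commutator [l_a, R_a] so that boundedness is immediate. Every letter a
    gives the same operator; the letter 0 exists because d > 0. *)
Definition qnum x :=
  l (Ordinal d_gt0) (rcre (Ordinal d_gt0) x) -
  rcre (Ordinal d_gt0) (l (Ordinal d_gt0) x).

Lemma bounded_qnum : bounded_op qnum.
Proof.
by apply: bounded_opB; apply: bounded_op_comp; (exact: bl || exact: bounded_rcre).
Qed.

(** Induction on w: L_b commutes with R_a, and when l_i moves past L_b the delta_ib terms cancel, so
    each letter contributes only a factor q. *)
Lemma l_rcre_word i a w :
  l i (rcre a (word_vec w)) - rcre a (l i (word_vec w)) =
  ((i == a)%:R * (q ^+ size w)%:C) *: word_vec w.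
Proof.
elim: w => [|b w IH].
  rewrite l_vacuum (lin0 (@linR a)) subr0 rcre_word /= -L_word l_L l_vacuum.
  by rewrite (lin0 (@linL a)) scaler0 addr0 mulr1.
rewrite -L_word -L_rcre !l_L (linD (@linR a)) !(linZ (@linR a)) opprD addrACA subrr add0r.
by rewrite -L_rcre -scalerBr -(linB (@linL b)) IH (linZ (@linL b)) scalerA exprS rmorphM mulrCA.
Qed.

Lemma qnum_word w : qnum (word_vec w) = (q ^+ size w)%:C *: word_vec w.
Proof. by rewrite /qnum l_rcre_word eqxx mul1r. Qed.

Lemma l_rcre i a x : l i (rcre a x) = rcre a (l i x) + (i == a)%:R *: qnum x.
Proof.
apply: (word_ext (f := fun x => l i (rcre a x))
  (g := fun x => rcre a (l i x) + (i == a)%:R *: qnum x)) => [||w].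
- exact/bounded_op_comp/bounded_rcre/bl.
- apply: bounded_opD; first exact/bounded_op_comp/bl/bounded_rcre.
  exact/bounded_opZ/bounded_qnum.
- by rewrite qnum_word scalerA -l_rcre_word addrC subrK.
Qed.

Lemma adj_qnum : adjoint qnum qnum.
Proof.
apply: (span_adjoint word_dense) bounded_qnum bounded_qnum _ => u v; rewrite /e.
rewrite !qnum_word hdotZl hdotZr hdot_word conjc_real.
have [->//|uv] := eqVneq (size u) (size v).
by rewrite qdot_size // !mulr0.
Qed.

Lemma rann_L a i x : rann a (L i x) = L i (rann a x) + (i == a)%:R *: qnum x.
Proof.
apply: hdot_ext => z.
by rewrite hdotDl hdotZl adj_rann adj_Ll l_rcre hdotDr hdotZr conjc_nat adj_Ll adj_rann adj_qnum.
Qed.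

Lemma qnum_rcre a x : qnum (rcre a x) = q%:C *: rcre a (qnum x).
Proof.
apply: (word_ext (f := fun x => qnum (rcre a x)) (g := fun x => q%:C *: rcre a (qnum x))) => [||w].
- exact/bounded_op_comp/bounded_rcre/bounded_qnum.
- exact/bounded_opZ/bounded_op_comp/bounded_qnum/bounded_rcre.
- by rewrite rcre_word !qnum_word (linZ (@linR a)) rcre_word size_rcons scalerA exprS rmorphM.
Qed.

Lemma rann_qnum a x : rann a (qnum x) = q%:C *: qnum (rann a x).
Proof.
apply: hdot_ext => z.
by rewrite adj_rann adj_qnum qnum_rcre hdotZl hdotZr conjc_real adj_qnum adj_rann.
Qed.

End Fock.

(* [cl], [al] ([cr], [ar]) are creation and annihilation on the left (on the
   right), and [qth] is q^N, N being the number operator. *)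
Record qfock (R : realType) (d : nat) (q : R) (F : hilbertType R) := QFock {
  eps_ : seq 'I_d -> F;
  cl : 'I_d -> F -> F;
  al : 'I_d -> F -> F;
  cr : 'I_d -> F -> F;
  ar : 'I_d -> F -> F;
  qth : F -> F;
  bcl : forall i, bounded_op (cl i);
  bal : forall i, bounded_op (al i);
  bcr : forall i, bounded_op (cr i);
  bar : forall i, bounded_op (ar i);
  bqth : bounded_op qth;
  cl_eps : forall i w, cl i (eps_ w) = eps_ (i :: w);
  cr_eps : forall i w, cr i (eps_ w) = eps_ (rcons w i);
  al_eps : forall i w, al i (eps_ w) = \sum_(p <- dels q i w) p.1%:C *: eps_ p.2;
  ar_vacuum : forall i, ar i (eps_ [::]) = 0;
  qth_eps : forall w, qth (eps_ w) = (q ^+ size w)%:C *: eps_ w;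
  hdot_eps_ : forall u v, hdot (eps_ u) (eps_ v) = (qdot q u v)%:C;
  dense_eps : dense (range (mlin (fun w : fmonom 'I_d => eps_ w)));
  adj_cl : forall i, adjoint (cl i) (al i);
  adj_cr : forall i, adjoint (cr i) (ar i);
  al_cl : forall i a x, al i (cl a x) = (i == a)%:R *: x + q%:C *: cl a (al i x);
  cl_cr : forall i a x, cl i (cr a x) = cr a (cl i x);
  al_ar : forall i a x, al i (ar a x) = ar a (al i x);
  al_cr : forall i a x, al i (cr a x) = cr a (al i x) + (i == a)%:R *: qth x;
  ar_cl : forall a i x, ar a (cl i x) = cl i (ar a x) + (i == a)%:R *: qth x;
  qth_cr : forall a x, qth (cr a x) = q%:C *: cr a (qth x);
  ar_qth : forall a x, ar a (qth x) = q%:C *: qth (ar a x)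
}.

(** What follows rests on the relations collected in M; the concrete completion returns only to
    identify the vacuum and the operators A. *)
Lemma qfock_exists (R : realType) (d : nat) (q : R) (F : hilbertType R)
    (iota : {linear fock_alg R d -> F}) (A : 'I_d -> F -> F) :
  (0 < d)%N -> q_fock_space q iota -> q_gaussians iota A ->
  exists M : qfock d q F,
    (forall w : fmonom 'I_d, eps_ M w = iota (fock_basis R w)) /\
    (forall i x, A i x = al M i x + cl M i x).
Proof.
move=> d0 hF hA.
have /choice[l hl] := hA; have {hl}/choice[L hL] := hl.
have bL i : bounded_op (L i) by case: (hL i).
have Lb i : forall w, L i (iota (fock_basis R w)) = iota (fock_basis R (mmul (fmu i) w)).
  by case: (hL i).
have bl i : bounded_op (l i) by case: (hL i).
have adj i : adjoint (L i) (l i) by case: (hL i).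
exists (QFock bL bl (bounded_rcre hF bL) (bounded_rann hF bl) (bounded_qnum d0 hF bL bl)
  (L_word Lb) (rcre_word hF Lb) (l_word hF Lb adj) (rann_vacuum hF Lb adj)
  (qnum_word d0 hF bL Lb bl adj) (hdot_word hF) (word_dense hF)
  adj (adj_rcre hF adj) (l_L hF bL Lb bl adj) (L_rcre hF bL Lb)
  (l_rann hF bL Lb adj) (l_rcre d0 hF bL Lb bl adj)
  (rann_L d0 hF bL Lb bl adj) (qnum_rcre d0 hF bL Lb bl adj) (rann_qnum d0 hF bL Lb bl adj)).
split; first by case.
by move=> i x; case: (hL i).
Qed.

(** * The basis dual to the words *)

(** Each factor is bounded by an exponential, with a constant arranged so that the exponents
    telescope. *)
Lemma geometric_factor_bound (R : realType) (t : R) (c : nat -> R) :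
  0 <= t -> t < 1 -> c 0%N = 1 ->
  (forall n, c n.+1 = c n * ((1 + t ^+ n.+1) / (1 - t ^+ n.+2))) ->
  exists2 K, 1 <= K & forall n, c n <= K.
Proof.
move=> t0 t1 c0 cS.
have t1' : 0 < 1 - t by rewrite subr_gt0.
(* With this C, C (t^(n+1) - t^(n+2)) is twice t^(n+1) / (1 - t): one copy for the numerator and one
   for the denominator. *)
pose C := 2 / (1 - t) ^+ 2.
have C0 : 0 <= C by rewrite divr_ge0 // exprn_ge0 // ltW.
have tn0 n : 0 <= t ^+ n by rewrite exprn_ge0.
have tn1 n : t ^+ n.+1 <= t.
  by rewrite exprS ler_piMr // exprn_ile1 // ltW.
have tn1' n : 0 < 1 - t ^+ n.+1 by rewrite subr_gt0 (le_lt_trans (tn1 n)).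
have ratio n : (1 + t ^+ n.+1) / (1 - t ^+ n.+2) <= expR (C * (t ^+ n.+1 - t ^+ n.+2)).
  set x := t ^+ n.+1; set y := t ^+ n.+2.
  have -> : C * (x - y) = x / (1 - t) + x / (1 - t).
    have yE : y = t * x by rewrite /y exprS.
    by rewrite /C yE; field; rewrite gt_eqF.
  rewrite expRD; apply: ler_pM.
  - exact: addr_ge0 ler01 (tn0 _).
  - by rewrite invr_ge0 ltW // tn1'.
  - apply: (le_trans (expR_ge1Dx _)); rewrite ler_expR.
    by rewrite ler_pdivlMr // ler_piMr ?gerBl //; exact: tn0.
  - have -> : (1 - y)^-1 = 1 + y / (1 - y).
      by field; rewrite gt_eqF // tn1'.
    apply: (le_trans (expR_ge1Dx _)); rewrite ler_expR.
    apply: ler_pM; rewrite ?tn0 ?invr_ge0 ?(ltW (tn1' _)) //.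
      by rewrite /y /x exprS ler_piMl // ltW.
    by rewrite lef_pV2 ?posrE ?tn1' // lerB // tn1.
exists (expR C); first by rewrite -expR0 ler_expR.
have cn n : 0 <= c n /\ c n <= expR (C * (1 - t ^+ n.+1)).
  elim: n => [|n [IH0 IH]].
    rewrite c0; split => //; rewrite -[X in X <= _]expR0 ler_expR mulr_ge0 //.
    exact/ltW/tn1'.
  rewrite cS; have f0 : 0 <= (1 + t ^+ n.+1) / (1 - t ^+ n.+2).
    by rewrite divr_ge0 //; [exact: addr_ge0 ler01 (tn0 _)|exact/ltW/tn1'].
  split; first by rewrite mulr_ge0.
  apply: (le_trans (ler_pM IH0 f0 IH (ratio n))).
  by rewrite -expRD -mulrDr addrA subrK.
by move=> n; apply: (le_trans (cn n).2); rewrite ler_expR ler_piMr // gerBl.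
Qed.

Section Dual.
Variables (R : realType) (d : nat) (q : R) (F : hilbertType R).
Variable M : qfock d q F.
Hypothesis q_lt1 : `|q| < 1.
Implicit Types (i a b : 'I_d) (u v w : seq 'I_d) (x y : F) (n : nat) (k : R).

Local Notation eps := (eps_ M).
Let lincl i : linear (cl M i) := bounded_op_lin (bcl M i).
Let linal i : linear (al M i) := bounded_op_lin (bal M i).
Let lincr i : linear (cr M i) := bounded_op_lin (bcr M i).
Let linth : linear (qth M) := bounded_op_lin (bqth M).

(** The bound is on the coefficients, not on the norm of y, so it is transported by every linear map
    whose values on words are controlled. *)
Definition comb n k y := exists s : seq (R * seq 'I_d),
  [/\ forall p, p \in s -> size p.2 = n,
      y = \sum_(p <- s) p.1%:C *: eps p.2 & \sum_(p <- s) `|p.1| <= k].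

Lemma comb_eps w : comb (size w) 1 (eps w).
Proof.
exists [:: (1, w)]; split; first by move=> p; rewrite inE => /eqP ->.
  by rewrite big_seq1 scale1r.
by rewrite big_seq1 normr1.
Qed.

Lemma comb0 n k : 0 <= k -> comb n k 0.
Proof. by exists [::]; split; rewrite ?big_nil. Qed.

Lemma comb_le n k k' y : k <= k' -> comb n k y -> comb n k' y.
Proof. by move=> kk' [s [h1 h2 h3]]; exists s; split => //; exact: le_trans kk'. Qed.

Lemma combP n (r : R) k k' x y :
  comb n k x -> comb n k' y -> comb n (`|r| * k + k') (r%:C *: x + y).
Proof.
move=> [s [h1 -> h3]] [s' [h1' -> h3']].
exists ([seq (r * p.1, p.2) | p <- s] ++ s'); split.
- by move=> p; rewrite mem_cat => /orP[/mapP[p' /h1 <- -> //]|/h1'].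
- rewrite big_cat big_map /= scaler_sumr; congr (_ + _).
  by apply: eq_bigr => p _; rewrite scalerA rmorphM.
rewrite big_cat big_map /= lerD //.
under eq_bigr do rewrite normrM.
by rewrite -mulr_sumr ler_wpM2l.
Qed.

(** Transfer principle: G x k stands for a notion of size at most k that is compatible with linear
    combinations. It is applied to norms, to [comb] itself, to solvability of equations for [al],
    and to operators on the tensor square. *)
Lemma comb_rec n k y (G : F -> R -> Prop) (C : R) :
  (forall x k k', k <= k' -> G x k -> G x k') -> G 0 0 ->
  (forall (r : R) x x' k k', G x k -> G x' k' -> G (r%:C *: x + x') (`|r| * k + k')) ->
  0 <= C -> (forall w, size w = n -> G (eps w) C) -> comb n k y -> G y (C * k).
Proof.
move=> Gle G0 GP C0 Ge [s [h1 -> h3]].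
apply: (Gle _ (C * \sum_(p <- s) `|p.1|)); first by rewrite ler_wpM2l.
elim: s h1 {h3} => [|p s IH] h1; first by rewrite !big_nil mulr0.
rewrite !big_cons mulrDr [C * `|_|]mulrC; apply: GP.
  by apply: Ge; apply: h1; rewrite mem_head.
by apply: IH => p' h; apply: h1; rewrite inE h orbT.
Qed.

Lemma comb_map n m k y (f : F -> F) (C : R) : linear f -> 0 <= C ->
  (forall w, size w = n -> comb m C (f (eps w))) -> comb n k y -> comb m (C * k) (f y).
Proof.
move=> lf C0 h; apply: (comb_rec (G := fun x k => comb m k (f x))) => //.
- by move=> x k1 k2; exact: comb_le.
- by rewrite (lin0 lf); exact: comb0.
- by move=> r x x' k1 k2 h1 h2; rewrite lf; exact: combP.
Qed.

Lemma comb_cl n k a y : comb n k y -> comb n.+1 k (cl M a y).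
Proof.
rewrite -{2}[k]mul1r; apply: comb_map => // w <-.
by rewrite cl_eps; exact: (comb_eps (a :: w)).
Qed.

Lemma comb_cr n k a y : comb n k y -> comb n.+1 k (cr M a y).
Proof.
rewrite -{2}[k]mul1r; apply: comb_map => // w <-.
by rewrite cr_eps -(size_rcons w a); exact: comb_eps.
Qed.

(** The deletions from one word carry distinct powers of q, whose absolute values sum to at most 1 /
    (1 - |q|). *)
Lemma comb_al n k a y : comb n.+1 k y -> comb n ((1 - `|q|)^-1 * k) (al M a y).
Proof.
have q1 : 0 < 1 - `|q| by rewrite subr_gt0.
apply: comb_map => //; first by rewrite invr_ge0 ltW.
elim: n => [|n IH] [|b w] //= [wn]; rewrite -cl_eps al_cl.
  rewrite (size0nil wn) al_eps big_nil (lin0 (lincl b)) scaler0.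
  apply: (@comb_le _ (`|(a == b)%:R| * 1 + 0)).
    rewrite addr0 mulr1 normr_nat; apply: (@le_trans _ _ 1); first by case: eqP.
    by rewrite invf_ge1 // gerBl.
  rewrite -(rmorph_nat (real_complex R)); apply: combP; last exact: comb0.
  exact: (comb_eps [::]).
have h := comb_cl b (IH w wn).
rewrite -(rmorph_nat (real_complex R)).
apply: (@comb_le _ (`|(a == b)%:R| * 1 + (`|q| * (1 - `|q|)^-1 + 0))).
  rewrite addr0 mulr1 normr_nat; apply: (@le_trans _ _ (1 + `|q| / (1 - `|q|))).
    by rewrite lerD2r; case: eqP.
  have -> : 1 + `|q| / (1 - `|q|) = (1 - `|q|)^-1 by field; rewrite gt_eqF.
  by [].
apply: combP; first by rewrite -wn; exact: comb_eps.
by rewrite -[_ *: cl _ _ _]addr0; apply: combP; last exact: comb0.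
Qed.

Lemma comb_qth n k y : comb n k y -> qth M y = (q ^+ n)%:C *: y.
Proof.
move=> [s [h1 -> _]]; rewrite (lin_sum linth) scaler_sumr big_seq_cond [RHS]big_seq_cond.
apply: eq_bigr => p; rewrite andbT => /h1 <-.
by rewrite (linZ linth) qth_eps !scalerA mulrC.
Qed.

Lemma comb_norm C n k y : (forall w, size w = n -> rnorm (eps w) <= C) -> 0 <= C ->
  comb n k y -> rnorm y <= C * k.
Proof.
move=> hC C0; apply: (comb_rec (G := fun x k => rnorm x <= k)) => //.
- by move=> x k1 k2 k12 h; exact: le_trans k12.
- by rewrite rnorm0.
- move=> r x x' k1 k2 h1 h2; apply: (le_trans (rnormD _ _)); rewrite rnormZr.
  by rewrite lerD // ler_wpM2l.
Qed.

(** Each factor is the cost of one more letter: the numerator comes from R_c - q^(m+1) L_c, the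
    denominator from inverting 1 - q^(m+2) rot. *)
Fixpoint kap n : R :=
  if n is m.+1 then kap m * ((1 + `|q| ^+ m.+1) / (1 - `|q| ^+ m.+2)) else 1.

Lemma comb_sum (I : eqType) (s : seq I) (c : I -> R) (f : I -> F) n k :
  0 <= k -> (forall m, m \in s -> comb n k (f m)) ->
  comb n (\sum_(m <- s) `|c m| * k) (\sum_(m <- s) (c m)%:C *: f m).
Proof.
move=> k0; elim: s => [|m s IH] h; first by rewrite !big_nil; exact: comb0.
rewrite !big_cons; apply: combP; first by apply: h; rewrite mem_head.
by apply: IH => m' hm; apply: h; rewrite inE hm orbT.
Qed.

Lemma kap_ge0 n : 0 <= kap n.
Proof.
elim: n => //= n IH; rewrite mulr_ge0 // divr_ge0 //.
by rewrite subr_ge0 exprn_ile1 // ltW.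
Qed.

(* Rotating the last letter c of a word to the front,
   l_b (R_c x - q^(n+1) L_c x) = R_c (l_b x) - q^(n+2) L_c (l_b x)
   for x of degree n+1. Hence a solution for all words of length n yields one for
   (1 - q^(n+2) rot) w, |w| = n+1, and 1 - q^(n+2) rot is inverted by a geometric
   sum since rot has finite order. *)
Lemma al_solve n a w : size w = n ->
  exists2 x, comb n.+1 (kap n) x & forall b, al M b x = (b == a)%:R *: eps w.
Proof.
elim: n w => [|n IH] w.
  move=> /size0nil ->; exists (eps [:: a]); first exact: (comb_eps [:: a]).
  by move=> b; rewrite -cl_eps al_cl al_eps big_nil (lin0 (lincl _)) scaler0 addr0.
move=> wn; set N := n.+1 in wn *.
(* y m is w with its last m letters moved to the front, so y 0 and y N are both w; this closes the
   telescoping sum below. *)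
pose y m := rot (N - m) w.
have yN m : size (y m) = N by rewrite size_rot.
have /choice[c hc] m : exists c, y m = rcons (take n (y m)) c.
  have := yN m; case/lastP: (y m) => // z c; rewrite size_rcons => -[zn].
  by exists c; rewrite -!cats1 take_size_cat.
have yS m : (m < N)%N -> y m.+1 = c m :: take n (y m).
  move=> mN; have e : y m = rot 1 (y m.+1).
    rewrite /y -rotS; last by rewrite wn subnS prednK ?subn_gt0 // leq_subr.
    by rewrite subnS prednK // subn_gt0.
  rewrite -[LHS](rotK 1) -e hc; rewrite rotr1_rcons; congr (_ :: _).
  by rewrite -hc.
have tn m : size (take n (y m)) = n by rewrite size_take yN ltnSn.
have /choice[X hX] m : exists x, comb n.+1 (kap n) x /\
    forall b, al M b x = (b == a)%:R *: eps (take n (y m)).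
  by have [x h1 h2] := IH _ (tn m); exists x.
set s := q ^+ n.+2.
have s1 : `|s| < 1 by rewrite normrX exprn_ilt1.
have sN : 1 - s ^+ N != 0.
  rewrite subr_eq0 eq_sym; apply/eqP => h; have : `|s ^+ N| < 1 by rewrite normrX exprn_ilt1.
  by rewrite h normr1 ltxx.
pose Z m := cr M (c m) (X m) - (q ^+ n.+1)%:C *: cl M (c m) (X m).
have alZ m b : (m < N)%N -> al M b (Z m) = (b == a)%:R *: (eps (y m) - s%:C *: eps (y m.+1)).
  move=> mN; rewrite /Z (linB (linal b)) (linZ (linal b)) al_cr al_cl.
  rewrite (comb_qth (hX m).1) scalerDr scalerA opprD addrA.
  rewrite [(q ^+ _)%:C *: ((b == _)%:R *: _)]scalerA.
  rewrite [(q ^+ n.+1)%:C * _]mulrC addrK !(hX m).2 (linZ (lincr _)) (linZ (lincl _)).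
  rewrite cr_eps cl_eps -hc -yS // !scalerA scalerBr scalerA; congr (_ - _ *: _).
  have -> : s%:C = (q ^+ n.+1)%:C * q%:C by rewrite /s exprSr rmorphM.
  by rewrite mulrC.
pose r m := s ^+ m / (1 - s ^+ N).
exists (\sum_(m <- iota 0 N) (r m)%:C *: Z m); last first.
  move=> b; rewrite (lin_sum (linal b)) big_seq_cond.
  rewrite (eq_bigr (fun m => ((b == a)%:R * ((1 - s ^+ N)^-1)%:C) *:
     ((s ^+ m)%:C *: eps (y m) - (s ^+ m.+1)%:C *: eps (y m.+1)))); last first.
    move=> m; rewrite andbT mem_iota add0n => /andP[_ mN].
    rewrite (linZ (linal b)) alZ // !scalerBr !scalerA /r.
    move: (1 - s ^+ N)^-1 (b == a)%:R => D z.
    by congr (_ *: _ - _ *: _); rewrite ?exprS; ring.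
  rewrite -big_seq_cond -scaler_sumr -/(index_iota 0 N).
  rewrite -[X in _ *: X]opprK -sumrN (eq_bigr _ (fun m _ => opprB _ _)).
  rewrite telescope_sumr // opprB expr0 scale1r /y subn0 subnn rot0 -wn rot_size wn.
  rewrite -{1}[eps w]scale1r -scalerBl scalerA -mulrA -(rmorph1 (real_complex R)) -rmorphB -rmorphM.
  by rewrite mulVf // rmorph1 mulr1.
have kZ m : comb n.+2 (kap n * (1 + `|q| ^+ n.+1)) (Z m).
  rewrite /Z -scaleNr [X in comb _ _ X]addrC -rmorphN.
  apply: (@comb_le _ (`|- q ^+ n.+1| * kap n + kap n)).
    by rewrite normrN normrX mulrDr mulr1 addrC mulrC.
  by apply: combP; [apply: comb_cl|apply: comb_cr]; exact: (hX m).1.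
apply: comb_le (@comb_sum _ (iota 0 N) r Z n.+2 (kap n * (1 + `|q| ^+ n.+1)) _ _).
- rewrite -mulr_suml -/(index_iota 0 N) big_mkord.
  have -> : \sum_(m < N) `|r m| = (\sum_(m < N) `|s| ^+ m) / `|1 - s ^+ N|.
    by rewrite mulr_suml; apply: eq_bigr => m _; rewrite /r normrM normrX normfV.
  have s1' : 0 < 1 - `|s| by rewrite subr_gt0.
  have -> : \sum_(m < N) `|s| ^+ m = (1 - `|s| ^+ N) / (1 - `|s|).
    apply: (mulfI (lt0r_neq0 s1')); rewrite -[LHS]opprK -mulNr opprB -subrX1.
    by rewrite opprB mulrCA mulfV ?mulr1 // gt_eqF.
  have -> : kap N = kap n * ((1 + `|q| ^+ n.+1) / (1 - `|s|)) by rewrite /= normrX.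
  have -> (D E Q k G : R) : Q * E / D * (k * G) = Q / D * (k * (G * E)).
    by move: D^-1 => D'; ring.
  (* Since 1 - |s|^N <= |1 - s^N|, the finite geometric sum costs no more than 1 / (1 - |s|). *)
  rewrite ler_piMl ?mulr_ge0 ?kap_ge0 ?addr_ge0 ?exprn_ge0 ?invr_ge0 ?(ltW s1') //.
  rewrite ler_pdivrMr ?normr_gt0 // mul1r.
  by have := lerB_dist 1 (s ^+ N); rewrite normr1 (normrX N s).
- by rewrite mulr_ge0 ?kap_ge0 // addr_ge0 // exprn_ge0.
- by move=> m _; exact: kZ.
Qed.

Lemma hdot_vacuum v : hdot (eps v) (eps [::]) = (v == [::])%:R.
Proof.
rewrite hdot_eps_; case: v => [|b v]; first by rewrite qdot_nil.
by rewrite qdot_cons /= big_nil.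
Qed.

(** Induction on the word: if x is dual to w and l_b z = delta_ba x for all b, then <L_b e_v, z> =
    <e_v, l_b z> shows that z is dual to a w. The pairing with the vacuum vanishes because z has
    positive degree. *)
Lemma dual_basis : exists2 K : R, 1 <= K & forall w,
  exists2 x, comb (size w) (K ^+ size w) x & forall v, hdot (eps v) x = (v == w)%:R.
Proof.
have [K K1 hK] : exists2 K, 1 <= K & forall n, kap n <= K.
  by apply: (@geometric_factor_bound _ `|q|).
exists K => //; elim=> [|a w [x hx hxd]].
  by exists (eps [::]); [rewrite expr0; exact: (comb_eps [::])|exact: hdot_vacuum].
pose G y k := exists2 z, comb (size w).+1 k z & forall b, al M b z = (b == a)%:R *: y.
have [z hz hzd] : G x (kap (size w) * K ^+ size w).
  apply: comb_rec hx; rewrite ?kap_ge0 //.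
  - by move=> y k k' kk' [z hz hzd]; exists z => //; exact: comb_le hz.
  - exists 0; first exact: comb0.
    by move=> b; rewrite (lin0 (linal b)) scaler0.
  - move=> r y y' k k' [z hz hzd] [z' hz' hzd']; exists (r%:C *: z + z').
      exact: combP.
    by move=> b; rewrite linal hzd hzd' scalerDr !scalerA mulrC.
  - by move=> v vw; exact: al_solve.
exists z.
  by apply: comb_le hz; rewrite /= exprS ler_wpM2r ?hK // exprn_ge0 // (le_trans ler01).
case=> [|b v].
  case: hz => s [h1 -> _]; rewrite hdot_sumr big_seq big1 // => p /h1.
  rewrite hdotZr hdot_eps_ qdot_nil; case: p.2 => // c t _.
  by rewrite rmorph0 mulr0.
rewrite -cl_eps adj_cl hzd hdotZr hxd conjc_nat eqseq_cons.
by case: (b == a); case: (v == w); rewrite ?mulr0 ?mul0r ?mulr1.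
Qed.

End Dual.

(** * The dual operators *)

Section DualSystem.
Variables (R : realType) (d : nat) (q : R) (F : hilbertType R).
Variable M : qfock d q F.
Implicit Types (i j a b : 'I_d) (u v w : seq 'I_d) (x y : F).

Local Notation eps := (eps_ M).
Local Notation e0 := (eps_ M [::]).
Let lincl i : linear (cl M i) := bounded_op_lin (bcl M i).
Let linal i : linear (al M i) := bounded_op_lin (bal M i).
Let lincr i : linear (cr M i) := bounded_op_lin (bcr M i).
Let linar i : linear (ar M i) := bounded_op_lin (bar M i).
Let linth : linear (qth M) := bounded_op_lin (bqth M).

Definition gauss j x := al M j x + cl M j x.

Lemma bounded_gauss j : bounded_op (gauss j).
Proof. exact: bounded_opD (bal M j) (bcl M j). Qed.

Let linA j : linear (gauss j) := bounded_op_lin (bounded_gauss j).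

Lemma al_vacuum j : al M j e0 = 0.
Proof. by rewrite al_eps big_nil. Qed.

Lemma adj_al j : adjoint (al M j) (cl M j).
Proof. exact/adjoint_sym/adj_cl. Qed.

Lemma adj_gauss j : adjoint (gauss j) (gauss j).
Proof. by move=> x y; rewrite /gauss hdotDl hdotDr adj_cl adj_al addrC. Qed.

Lemma gauss_cr j a x : gauss j (cr M a x) = cr M a (gauss j x) + (j == a)%:R *: qth M x.
Proof. by rewrite /gauss al_cr cl_cr (linD (lincr a)) addrAC. Qed.

Definition ar_word w x := foldr (ar M) x w.

Lemma ar_word_lin w : linear (ar_word w).
Proof. by elim: w => [|a w IH] c x y //=; rewrite IH linar. Qed.

Lemma ar_word_qth w x : ar_word w (qth M x) = (q ^+ size w)%:C *: qth M (ar_word w x).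
Proof.
elim: w => [|a w IH] /=; first by rewrite expr0 scale1r.
by rewrite IH (linZ (linar a)) ar_qth scalerA exprSr rmorphM.
Qed.

Lemma al_ar_word j w x : al M j (ar_word w x) = ar_word w (al M j x).
Proof. by elim: w => [|a w IH] //=; rewrite al_ar IH. Qed.

(** Each annihilator in r_w meets L_j with [r_a, L_j] = delta_ja q^N, and moving q^N to x past the
    remaining ones gives negative powers of q. The factor q^|w| clears them. *)
Lemma ar_word_cl j w x :
  (q ^+ size w)%:C *: (ar_word w (cl M j x) - cl M j (ar_word w x)) =
  q%:C *: \sum_(p <- dels q j w) p.1%:C *: ar_word p.2 (qth M x).
Proof.
elim: w => [|a w IH] /=; first by rewrite subrr big_nil !scaler0.
have -> : ar M a (ar_word w (cl M j x)) - cl M j (ar M a (ar_word w x)) =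
    ar M a (ar_word w (cl M j x) - cl M j (ar_word w x)) +
    (j == a)%:R *: qth M (ar_word w x).
  by rewrite (linB (linar a)) ar_cl opprD addrA subrK.
rewrite exprS rmorphM /= scalerDr -!scalerA -(linZ (linar a)) IH.
rewrite big_cat big_map /= [in RHS]scalerDr [in RHS]addrC; congr (_ + _).
  rewrite (linZ (linar a)) (lin_sum (linar a)); congr (_ *: _).
  rewrite scaler_sumr; apply: eq_bigr => p _.
  by rewrite (linZ (linar a)) scalerA rmorphM.
congr (_ *: _); rewrite scalerA mulrC -scalerA -ar_word_qth eq_sym.
by case: (a == j); rewrite ?big_nil ?big_seq1 ?scale0r // !scale1r.
Qed.

(* c_n = (-1)^n q^(n(n+1)/2). *)
Fixpoint cq n : R := if n is m.+1 then - (q ^+ m.+1 * cq m) else 1.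

(** The recursion of [cq] absorbs q^|w| and leaves the coefficients of the shortened words. *)
Lemma cq_ar_word_cl j w x :
  (cq (size w))%:C *: (ar_word w (cl M j x) - cl M j (ar_word w x)) =
  - \sum_(p <- dels q j w) (q * p.1 * cq (size p.2))%:C *: ar_word p.2 (qth M x).
Proof.
case: w => [|a w]; first by rewrite /= subrr big_nil scaler0 oppr0.
have -> : cq (size (a :: w)) = - (cq (size w) * q ^+ size (a :: w)) by rewrite /= mulrC.
rewrite rmorphN scaleNr; congr (- _).
rewrite rmorphM -scalerA ar_word_cl !scaler_sumr big_seq [RHS]big_seq.
apply: eq_bigr => p /dels_size [<-].
by rewrite !scalerA; congr (_ *: _); rewrite !rmorphM mulrC.
Qed.

Section OneIndex.
Variable i : 'I_d.

(* [dualop w x] sums, over the factorizations w = u i v, the vectors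
   c_|v| r_v (R_u x), where R_u creates u on the right of x and r_v annihilates
   v on the right; the dual operator D_i maps e_w to [dualop w e0]. *)
Fixpoint dualop w x : F :=
  if w is a :: w' then
    ((a == i)%:R * (cq (size w'))%:C) *: ar_word w' x + dualop w' (cr M a x)
  else 0.

Lemma dualop_lin w : linear (dualop w).
Proof.
elim: w => [|a w IH] c x y /=; first by rewrite scaler0 addr0.
rewrite lincr IH ar_word_lin !scalerDr addrACA; congr (_ + _ + (_ + _)).
by rewrite !scalerA mulrC.
Qed.

(** A_j is moved outward past R_u and r_v. The letters of u give deletions through [A_j, R_a] =
    delta_ja q^N, those of v through [r_v, L_j]; together these are the terms of [dels q j w]. *)
Lemma dualop_gauss j w x :
  dualop w (gauss j x) =
  gauss j (dualop w x) - \sum_(p <- dels q j w) p.1%:C *: dualop p.2 (qth M x).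
Proof.
elim: w x => [|a w IH] x /=; first by rewrite big_nil (lin0 (linA j)) subr0.
have ecr : cr M a (gauss j x) = gauss j (cr M a x) - (j == a)%:R *: qth M x.
  by rewrite gauss_cr addrK.
rewrite ecr (linB (@dualop_lin w)) (linZ (@dualop_lin w)) IH.
rewrite (linD (linA j)) (linZ (linA j)) qth_cr.
set X := ar_word w x.
have eX : ar_word w (gauss j x) = gauss j X + (ar_word w (cl M j x) - cl M j X).
  by rewrite /gauss (linD (@ar_word_lin w)) al_ar_word -addrA subrKC.
rewrite eX scalerDr -[_ *: (ar_word _ _ - _)]scalerA cq_ar_word_cl scalerN.
rewrite big_cat big_map /=.
have -> : \sum_(p <- (if a == j then [:: (1, w)] else [::])) p.1%:C *: dualop p.2 (qth M x) =
   (j == a)%:R *: dualop w (qth M x).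
  by rewrite eq_sym; case: eqP; rewrite ?big_nil ?big_seq1 ?scale0r ?scale1r.
have -> : \sum_(p <- dels q j w) (q * p.1)%:C *:
     (((a == i)%:R * (cq (size p.2))%:C) *: ar_word p.2 (qth M x) +
        dualop p.2 (cr M a (qth M x))) =
   (a == i)%:R *: (\sum_(p <- dels q j w) (q * p.1 * cq (size p.2))%:C *: ar_word p.2 (qth M x)) +
   \sum_(p <- dels q j w) p.1%:C *: dualop p.2 (q%:C *: cr M a (qth M x)).
  rewrite scaler_sumr -big_split /=; apply: eq_bigr => p _.
  rewrite scalerDr (linZ (@dualop_lin _)) !scalerA; congr (_ *: _ + _ *: _).
    by rewrite [in RHS]rmorphM mulrCA.
  by rewrite rmorphM mulrC.
set P := (_ *: gauss j X); set T := _ *: \sum_(p <- _) _; set S := \sum_(p <- _) _.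
set U := gauss j _; set V := _ *: dualop w _.
rewrite -[RHS]addrA -[LHS]addrA; congr (_ + _).
move: U T S V => U' T' S' V'.
by rewrite !opprD -!addrA [LHS]addrCA; congr (_ + _); rewrite [RHS]addrC -addrA.
Qed.

Lemma ar_word_vacuum w : ar_word w e0 = (w == [::])%:R *: e0.
Proof.
elim: w => [|a w IH]; first by rewrite scale1r.
by rewrite /= IH (linZ (linar a)) ar_vacuum scaler0 scale0r.
Qed.

(* Once [dualop ^~ e0] is extended linearly to D_i, the left side is
   D_i (A_j e_w), so this says [D_i, A_j] = delta_ij P. *)
Lemma dualop_vacuum j w :
  dualop (j :: w) e0 + \sum_(p <- dels q j w) p.1%:C *: dualop p.2 e0 =
  gauss j (dualop w e0) + ((i == j)%:R * (w == [::])%:R) *: e0.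
Proof.
(* On the vacuum R_j and A_j agree, so the summands in which j belongs to u have the shape treated
   by [dualop_gauss]. *)
have -> : dualop (j :: w) e0 =
    ((j == i)%:R * (cq (size w))%:C) *: ar_word w e0 + dualop w (gauss j e0).
  by rewrite /= /gauss al_vacuum add0r cl_eps cr_eps.
rewrite dualop_gauss qth_eps scale1r -addrA subrK addrC; congr (_ + _).
rewrite ar_word_vacuum scalerA eq_sym; congr (_ *: _).
by case: w => [|? ?]; rewrite ?mulr1 ?mulr0.
Qed.

(** Here u collects the letters already read; with u empty this is the functional to be
    represented. *)
Fixpoint phi u w : R :=
  if w is a :: w' then
    (a == i)%:R * cq (size w') * qdot q u w' + phi (rcons u a) w'
  else 0.

Lemma hdot_ar_word w x u : hdot (ar_word w x) (eps u) = hdot x (eps (u ++ w)).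
Proof.
elim: w u => [|a w IH] u /=; first by rewrite cats0.
by rewrite (adjoint_sym (adj_cr M a)) cr_eps IH cat_rcons.
Qed.

Lemma hdot_dualop u w : hdot (dualop w (eps u)) e0 = (phi u w)%:C.
Proof.
elim: w u => [|a w IH] u /=; first by rewrite hdot0l.
rewrite hdotDl hdotZl hdot_ar_word hdot_eps_ cr_eps IH rmorphD !rmorphM /=.
by rewrite rmorph_nat.
Qed.

Lemma phi_short u w : (size w <= size u)%N -> phi u w = 0.
Proof.
elim: w u => //= a w IH u wu; rewrite IH ?size_rcons; last by rewrite ltnW // ltnW.
by rewrite addr0 qdot_size ?mulr0 // neq_ltn wu orbT.
Qed.

(** Words of different lengths are orthogonal, so only a factorization with i exactly in the middle
    of u w contributes. Then |u| + |w| is odd and its half is the length of the right part; C + 1 >=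
    1 pays for the middle letter in the exponent. *)
Lemma phi_bound (C : R) u w : 0 <= C ->
  (forall v, rnorm (eps v) <= C ^+ size v) ->
  `|phi u w| <= `|cq (size u + size w)./2| * (C + 1) ^+ (size u + size w).
Proof.
move=> C0 hC; elim: w u => [|a w IH] u /=.
  by rewrite normr0 mulr_ge0 // exprn_ge0 // addr_ge0.
have [uw|uw] := eqVneq (size u) (size w); last first.
  rewrite qdot_size // mulr0 add0r addnS -addSn -(size_rcons u a); exact: IH.
rewrite phi_short; last by rewrite size_rcons uw.
rewrite addr0 uw addnS addnn -[_.+1./2]/(uphalf _) uphalf_double.
rewrite normrM normrM normr_nat -mulrA.
apply: (@le_trans _ _ (`|cq (size w)| * `|qdot q u w|)).
  by rewrite ler_piMl ?mulr_ge0 //; case: eqP.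
rewrite ler_wpM2l // -rnorm_real -(hdot_eps_ M); apply: (le_trans (hdot_CS _ _)).
apply: (le_trans (ler_pM (rnorm_ge0 _) (rnorm_ge0 _) (hC u) (hC w))).
rewrite -exprD uw addnn; apply: (@le_trans _ _ ((C + 1) ^+ (size w).*2)).
  by apply: lerXn2r; rewrite ?nnegrE ?addr_ge0 // lerDl.
by rewrite exprS ler_peMl ?exprn_ge0 ?addr_ge0 // lerDr.
Qed.

End OneIndex.

Lemma eps_bound : exists2 C : R, 1 <= C & forall w, rnorm (eps w) <= C ^+ size w.
Proof.
have /choice[C hC] j : exists C : R, 0 <= C /\ forall x, rnorm (cl M j x) <= C * rnorm x.
  by have /bounded_opP[_ [C C0 h]] := bcl M j; exists C.
exists (1 + \sum_j C j); first by rewrite lerDl sumr_ge0 // => j _; case: (hC j).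
have C0 : 0 <= 1 + \sum_j C j by rewrite addr_ge0 // sumr_ge0 // => j _; case: (hC j).
elim=> [|a w IH].
  have : rnorm e0 ^+ 2 = 1.
    by apply: complexI; rewrite -hdotxx hdot_eps_ qdot_nil.
  move=> /eqP; rewrite expr0 -{1}(expr1n _ 2) eqrXn2 ?rnorm_ge0 // => /eqP -> //.
rewrite -cl_eps /= exprS; apply: (le_trans ((hC a).2 _)).
apply: ler_pM; rewrite ?rnorm_ge0 //; first by case: (hC a).
rewrite (bigD1 a) //= addrCA lerDl addr_ge0 // sumr_ge0 // => j _; by case: (hC j).
Qed.

Hypothesis q_lt1 : `|q| < 1.

(** For every rho, consecutive terms of |c_m| rho^m have ratio rho |q|^(m+1), eventually at most 1,
    so the sequence is bounded by its first terms. *)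
Lemma cq_small (k : R) : 0 <= k -> exists Q : R, forall n,
  `|cq n./2| * k ^+ n <= Q * 2^-1 ^+ n.
Proof.
(* s exceeds 2 k, which leaves room for 2^-n, and is at least 1, so that s^n <= s rho^(n/2) holds
   with the integer half also for odd n. *)
move=> k0; pose s := 2 * k + 1; pose rho := s ^+ 2.
have s0 : 0 <= s by rewrite addr_ge0 // mulr_ge0.
have s1 : 1 <= s by rewrite lerDr mulr_ge0.
have rho0 : 0 <= rho by rewrite exprn_ge0.
pose g m := `|cq m| * rho ^+ m.
have g0 m : 0 <= g m by rewrite mulr_ge0 // exprn_ge0.
have gS m : g m.+1 = g m * (rho * `|q| ^+ m.+1).
  rewrite /g /= normrN normrM normrX (exprS rho).
  have e (z c r t : R) : z * c * (r * t) = c * t * (r * z) by ring.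
  exact: e.
have [N hN] := expr_small rho (normr_ge0 q) q_lt1.
have gle m : g m <= \sum_(n < N.+1) g n.
  elim: m => [|m IH].
    by rewrite (bigD1 ord0) //= lerDl sumr_ge0.
  have [mN|Nm] := leqP m.+1 N.
    by rewrite (bigD1 (Ordinal (mN : (m.+1 < N.+1)%N))) //= lerDl sumr_ge0.
  rewrite gS; apply: (le_trans _ IH); rewrite ler_piMr //; apply: hN.
  by rewrite ltnW.
exists (s * \sum_(n < N.+1) g n) => n.
rewrite exprVn ler_pdivlMr ?exprn_gt0 // -mulrA -exprMn.
apply: (@le_trans _ _ (s * g n./2)); last by rewrite ler_wpM2l.
rewrite /g mulrCA ler_wpM2l //.
apply: (@le_trans _ _ (s ^+ n)).
  by apply: lerXn2r; rewrite ?nnegrE ?mulr_ge0 // mulrC lerDl.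
rewrite /rho -exprM -exprS; apply: ler_weXn2l => //.
by rewrite mul2n -{1}(odd_double_half n) -[_.+1]add1n leq_add2r; case: odd.
Qed.

(* The vector D_i^* e0, as a series whose n-th term is a combination of words
   of length n, with superexponentially small coefficients. *)
Lemma dual_vector i : exists (k Q : R) (y : nat -> F) (xi : F),
  [/\ 0 <= k, forall n, comb M n (`|cq n./2| * k ^+ n) (y n),
      forall n, rnorm (\sum_(m < n) y m - xi) <= Q * 2^-1 ^+ n &
      forall w, hdot (eps w) xi = (phi i [::] w)%:C].
Proof.
have [C C1 hC] := eps_bound.
have C0 : 0 <= C := le_trans ler01 C1.
have [K K1 hK] := dual_basis M q_lt1.
have K0 : 0 <= K := le_trans ler01 K1.
have /choice[e he] w : exists x, comb M (size w) (K ^+ size w) x /\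
    forall v, hdot (eps v) x = (v == w)%:R.
  by have [x h1 h2] := hK w; exists x.
(* There are d^n words of length n; on each the functional is at most |c| (C + 1)^n, and the dual
   vector has size K^n. *)
pose k := d%:R * (C + 1) * K.
have k0 : 0 <= k by rewrite !mulr_ge0 // addr_ge0.
pose y n : F := \sum_(t <- enum {: n.-tuple 'I_d}) (phi i [::] t)%:C *: e t.
have yc n : comb M n (`|cq n./2| * k ^+ n) (y n).
  apply: comb_le (@comb_sum _ _ _ _ M _ (enum {: n.-tuple 'I_d})
    (fun t => phi i [::] t) (fun t => e (tval t)) n (K ^+ n) _ _).
  - rewrite big_enum /= (@le_trans _ _ (\sum_(t : n.-tuple 'I_d)
      (`|cq n./2| * (C + 1) ^+ n * K ^+ n))) //.
      apply: ler_sum => t _; rewrite ler_wpM2r ?exprn_ge0 //.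
      by have := phi_bound i [::] t C0 hC; rewrite add0n size_tuple.
    rewrite sumr_const card_tuple card_ord -mulr_natl natrX /k !exprMn.
    have h (z c r t : R) : z * (c * r * t) = c * (z * r * t) by ring.
    by rewrite h.
  - by rewrite exprn_ge0.
  - by move=> t _; have := (he t).1; rewrite size_tuple.
have hy w n : hdot (eps w) (y n) = if size w == n then (phi i [::] w)%:C else 0.
  rewrite /y hdot_sumr big_enum /=.
  under eq_bigr => t _ do rewrite hdotZr conjc_real (he t).2.
  case: eqP => [wn|wn].
    rewrite (bigD1 (tcast wn (in_tuple w))) //= val_tcast eqxx mulr1 big1 ?addr0 // => t tw.
    case: eqP => [wt|]; last by rewrite mulr0.
    by move: tw; rewrite -(inj_eq val_inj) /= val_tcast wt eqxx.
  rewrite big1 // => t _; case: eqP => [wt|]; last by rewrite mulr0.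
  by case: wn; rewrite wt size_tuple.
have [Q hQ] := cq_small (mulr_ge0 k0 C0).
have [xi hxi] : exists xi, forall n, rnorm (\sum_(m < n) y m - xi) <= 2 * Q * 2^-1 ^+ n.
  apply: (@cauchy_geometric _ _ (fun n => \sum_(m < n) y m)) => n.
  rewrite big_ord_recr /= addrC addrK; apply: le_trans (hQ n).
  rewrite exprMn mulrA mulrC; apply: comb_norm (yc n); last by rewrite exprn_ge0.
  by move=> w <-.
exists k, (2 * Q), y, xi; split => // w.
apply/eqP; rewrite -subr_eq0; apply/eqP/rnorm0_eq0.
apply: (@le0_small _ _ (rnorm (eps w))) => e' e'0.
have [N hN] := half_pow_small (2 * Q) e'0.
pose n := maxn N (size w).+1.
have -> : (phi i [::] w)%:C = hdot (eps w) (\sum_(m < n) y m).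
  have wn : (size w < n)%N by rewrite leq_maxr.
  rewrite hdot_sumr (bigD1 (Ordinal wn)) //= hy eqxx big1 ?addr0 // => m mw.
  by rewrite hy; case: eqP => // wm; move: mw; rewrite -(inj_eq val_inj) /= wm eqxx.
rewrite -hdotBr; apply: (le_trans (hdot_CS _ _)); rewrite ler_wpM2l ?rnorm_ge0 //.
rewrite rnorm_distC; apply: (le_trans (hxi _)); apply: ltW; apply: hN.
exact: leq_maxl.
Qed.

End DualSystem.

(** * Dual and conjugate system *)

Lemma eq_comb (K : pzRingType) (V : lmodType K) (a : K) (x x' y y' : V) :
  x = x' -> y = y' -> a *: x + y = a *: x' + y'.
Proof. by move=> -> ->. Qed.

Lemma word_eval_lin (R : realType) d (V : hilbertType R) (X : 'I_d -> V -> V) :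
  (forall j, linear (X j)) -> forall w : fmonom 'I_d, linear (word_eval X w).
Proof. by move=> lX [w] c x y; rewrite /word_eval /=; elim: w => //= a w ->; rewrite lX. Qed.

Lemma nc_eval_basis (R : realType) d (V : hilbertType R) (X : 'I_d -> V -> V) w x :
  nc_eval X (mkmalgU w 1) x = word_eval X w x.
Proof. exact: mlin_basis. Qed.

Lemma nc_evalP (R : realType) d (V : hilbertType R) (X : 'I_d -> V -> V) a P Q x :
  nc_eval X (a *: P + Q) x = a *: nc_eval X P x + nc_eval X Q x.
Proof. exact: mlin_is_linear. Qed.

Lemma malg_mulP (R : realType) (K : monomType) (a : R[i]) (x y z : malg K R[i]) :
  z * (a *: x + y) = a *: (z * x) + z * y.
Proof. by rewrite mulrDr malg_scalerAr. Qed.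

Lemma ncvar_mulU (R : realType) d (j : 'I_d) (w : fmonom 'I_d) :
  ncvar R j * mkmalgU w 1 = mkmalgU (FMonom (j :: w)) 1 :> ncpoly R d.
Proof.
rewrite /ncvar malgM_def fgmulUU mulr1; congr (mkmalgU _ 1).
by apply/eqP; rewrite fmP fmM fmU.
Qed.

Lemma nc_eval_var (R : realType) d (V : hilbertType R) (X : 'I_d -> V -> V) j Q x :
  (forall j, linear (X j)) -> nc_eval X (ncvar R j * Q) x = X j (nc_eval X Q x).
Proof.
move=> lX; elim/malg_basis_ind: Q => [|w|a P Q IH IH'].
- by rewrite mulr0 /nc_eval !linear0 (lin0 (lX j)).
- by rewrite ncvar_mulU !nc_eval_basis.
- rewrite [_ * _]malg_mulP [LHS]nc_evalP [in RHS]nc_evalP [RHS]lX.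
  exact: eq_comb IH IH'.
Qed.

Section Conjugate.
Variables (R : realType) (d : nat) (q : R) (F : hilbertType R).
Variable M : qfock d q F.
Hypothesis q_lt1 : `|q| < 1.
Implicit Types (i j : 'I_d) (u v w : seq 'I_d) (x y : F).

Local Notation eps := (eps_ M).
Local Notation e0 := (eps_ M [::]).
Local Notation A := (gauss M).

Lemma gauss_lin j : linear (A j).
Proof. exact: bounded_op_lin (bounded_gauss M j). Qed.

Lemma gauss_wordP w a x y :
  foldr A (a *: x + y) w = a *: foldr A x w + foldr A y w.
Proof. exact: (word_eval_lin gauss_lin (FMonom w)). Qed.

Lemma gauss_word0 w : foldr A 0 w = 0.
Proof. exact: (lin0 (word_eval_lin gauss_lin (FMonom w))). Qed.

Definition emb : fock_alg R d -> F := mlin (fun w : fmonom 'I_d => eps w).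

Lemma emb_lin : linear emb.
Proof. exact: mlin_is_linear. Qed.

Lemma emb_basis w : emb (mkmalgU (FMonom w) 1) = eps w.
Proof. exact: mlin_basis. Qed.

(** Pairing with the dual basis reads off the coefficients. Through this an operator given on words
    becomes an operator on a domain in F. *)
Lemma emb_inj : injective emb.
Proof.
move=> x y exy; have [K _ hK] := dual_basis M q_lt1.
apply/malgP => -[w]; have [z _ hz] := hK w.
have h (t : fock_alg R d) : mcoeff (FMonom w) t = hdot (emb t) z.
  elim/malg_basis_ind: t => [|[v]|a t t' IH IH'].
  - by rewrite mcoeff0 (lin0 emb_lin) hdot0l.
  - rewrite mcoeffU emb_basis hz; case: eqP => [[->]|h]; first by rewrite eqxx.
    by case: eqP => // e; case: h; rewrite e.
  - by rewrite mcoeffD mcoeffZ IH IH' emb_lin hdotDl hdotZl.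
by rewrite !h exy.
Qed.

(** A_j on the algebraic Fock space, where D_i is defined by its values on words. *)
Definition gauss_alg j : fock_alg R d -> fock_alg R d :=
  mlin (fun w : fmonom 'I_d => mkmalgU (FMonom (j :: w)) 1 +
    \sum_(p <- dels q j w) p.1%:C *: mkmalgU (FMonom p.2) 1).

Lemma gauss_alg_lin j : linear (gauss_alg j).
Proof. exact: mlin_is_linear. Qed.

Lemma gauss_alg_basis j w : gauss_alg j (mkmalgU (FMonom w) 1) =
  mkmalgU (FMonom (j :: w)) 1 + \sum_(p <- dels q j w) p.1%:C *: mkmalgU (FMonom p.2) 1.
Proof. exact: mlin_basis. Qed.

Lemma emb_gauss j (x : fock_alg R d) : emb (gauss_alg j x) = A j (emb x).
Proof.
elim/malg_basis_ind: x => [|[w]|a x y IH IH'].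
- by rewrite (lin0 (gauss_alg_lin j)) (lin0 emb_lin) (lin0 (gauss_lin j)).
- rewrite gauss_alg_basis (linD emb_lin) (lin_sum emb_lin) !emb_basis /gauss cl_eps al_eps addrC.
  by congr (_ + _); apply: eq_bigr => p _; rewrite (linZ emb_lin) emb_basis.
- rewrite gauss_alg_lin !emb_lin [RHS]gauss_lin.
  exact: eq_comb IH IH'.
Qed.

Definition dual_alg i : fock_alg R d -> F :=
  mlin (fun w : fmonom 'I_d => dualop M i w e0).

Lemma dual_alg_lin i : linear (dual_alg i).
Proof. exact: mlin_is_linear. Qed.

Lemma dual_alg_basis i w : dual_alg i (mkmalgU (FMonom w) 1) = dualop M i w e0.
Proof. exact: mlin_basis. Qed.

Lemma dual_alg_gauss i j (x : fock_alg R d) :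
  dual_alg i (gauss_alg j x) =
  A j (dual_alg i x) + ((i == j)%:R * hdot (emb x) e0) *: e0.
Proof.
elim/malg_basis_ind: x => [|[w]|a x y IH IH'].
- rewrite (lin0 (gauss_alg_lin j)) (lin0 (dual_alg_lin i)) (lin0 (gauss_lin j)) (lin0 emb_lin).
  by rewrite hdot0l mulr0 scale0r addr0.
- rewrite emb_basis hdot_vacuum dual_alg_basis -dualop_vacuum.
  rewrite gauss_alg_basis (linD (dual_alg_lin i)) (lin_sum (dual_alg_lin i)) dual_alg_basis.
  by congr (_ + _); apply: eq_bigr => p _; rewrite (linZ (dual_alg_lin i)) dual_alg_basis.
rewrite gauss_alg_lin !dual_alg_lin [X in _ = X + _]gauss_lin emb_lin hdotDl hdotZl.
have -> : ((i == j)%:R * (a * hdot (emb x) e0 + hdot (emb y) e0)) *: e0 =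
    a *: (((i == j)%:R * hdot (emb x) e0) *: e0) + ((i == j)%:R * hdot (emb y) e0) *: e0.
  by rewrite mulrDr scalerDl scalerA mulrCA.
rewrite addrACA -scalerDr.
exact: eq_comb IH IH'.
Qed.

Definition gauss_word w : fock_alg R d := foldr gauss_alg (mkmalgU (FMonom [::]) 1) w.

Lemma emb_gauss_word w : emb (gauss_word w) = foldr A e0 w.
Proof. by elim: w => [|a w IH] /=; [exact: emb_basis|rewrite emb_gauss IH]. Qed.

Lemma nc_alg_emb x : nc_alg A e0 x -> exists t, emb t = x.
Proof.
move=> [Q _ <-]; elim/malg_basis_ind: Q => [|[w]|a P Q [t IH] [t' IH']].
- by exists 0; rewrite /nc_eval (lin0 emb_lin) linear0.
- by exists (gauss_word w); rewrite nc_eval_basis emb_gauss_word.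
- by exists (a *: t + t'); rewrite emb_lin nc_evalP IH IH'.
Qed.

(** Strong induction on the length: e_(aw) = A_a e_w - l_a e_w, and l_a e_w is a combination of
    shorter words. *)
Lemma eps_nc_alg w : nc_alg A e0 (eps w).
Proof.
elim: {w}(size w).+1 {-2}w (ltnSn (size w)) => // n IH [|a w] wn.
  by exists (mkmalgU (FMonom [::]) 1) => //; rewrite nc_eval_basis.
have [P _ eP] := IH w wn.
have [Q eQ] : exists Q, nc_eval A Q e0 = al M a (eps w).
  rewrite al_eps.
  have : forall p, p \in dels q a w -> (size p.2 < n)%N.
    by move=> p /dels_size e; move: wn; rewrite /= e ltnS => /ltnW.
  elim: (dels q a w) => [|p s IHs] h.
    by exists 0; rewrite big_nil /nc_eval linear0.
  have [|Q eQ] := IHs; first by move=> p' h'; apply: h; rewrite inE h' orbT.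
  have [|P' _ eP'] := IH p.2; first by apply: h; rewrite mem_head.
  by exists (p.1%:C *: P' + Q); rewrite nc_evalP big_cons eP' eQ.
exists ((-1) *: Q + ncvar R a * P) => //.
rewrite nc_evalP nc_eval_var; last exact: gauss_lin.
by rewrite eP eQ /gauss cl_eps scaleN1r addKr.
Qed.

Section Vector.
Variable xi : 'I_d -> F.
Hypothesis xiE : forall i w, hdot (eps w) (xi i) = (phi q i [::] w)%:C.

Lemma hdot_xi i (t : fock_alg R d) : hdot (emb t) (xi i) = hdot (dual_alg i t) e0.
Proof.
elim/malg_basis_ind: t => [|[w]|a x y IH IH'].
- by rewrite (lin0 emb_lin) (lin0 (dual_alg_lin i)) !hdot0l.
- by rewrite emb_basis dual_alg_basis hdot_dualop xiE.
- by rewrite emb_lin dual_alg_lin !hdotDl !hdotZl IH IH'.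
Qed.

Lemma dual_system_exists : exists D, normalized_dual_system A e0 D.
Proof.
(* The default 0 occurs only outside the range of [emb], that is, outside the domain. *)
pose inv y : fock_alg R d := xget 0 [set t | emb t = y].
have invK t : inv (emb t) = t.
  by rewrite /inv; apply: emb_inj; case: xgetP => [z -> //|/(_ t)]; case.
pose dom : set F := range emb.
have dom0 : dom 0 by exists 0 => //; rewrite (lin0 emb_lin).
have domP (a : R[i]) x y : dom x -> dom y -> dom (a *: x + y).
  by move=> [t _ <-] [t' _ <-]; exists (a *: t + t') => //; rewrite emb_lin.
have opP i (a : R[i]) x y : dom x -> dom y ->
    dual_alg i (inv (a *: x + y)) = a *: dual_alg i (inv x) + dual_alg i (inv y).
  by move=> [t _ <-] [t' _ <-]; rewrite -emb_lin !invK dual_alg_lin.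
exists (fun i => UnboundedOp dom0 domP (opP i)) => i; split => /=.
- by move=> x /nc_alg_emb[t <-]; exists t.
- by rewrite -emb_basis invK dual_alg_basis.
- by exists (xi i) => _ [t _ <-]; rewrite /= invK hdot_xi.
move=> j x /nc_alg_emb[t <-]; rewrite -emb_gauss !invK dual_alg_gauss addrC addKr.
by rewrite /proj_unit; case: eqP; rewrite ?mul1r // mul0r scale0r.
Qed.

Lemma adj_word w x y : hdot (foldr A x w) y = hdot x (foldr A y (rev w)).
Proof.
elim: w x y => [|a w IH] x y //=.
by rewrite rev_cons -cats1 foldr_cat /= adj_gauss IH.
Qed.

Local Notation tau w := (hdot (foldr A e0 w) e0).

Lemma tau_rev w : conjc (tau (rev w)) = tau w.
Proof. by rewrite -hdotC adj_word. Qed.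

(** Commuting D_i past the operator of the last letter of w moves that letter to u and, if it is i,
    splits off a product of two traces; D_i e0 = 0 ends the recursion. The reversals and the
    conjugation come from <A_w xi, e0> = conj <A_(rev w) e0, xi>. *)
Lemma hdot_dual_word i u w :
  conjc (hdot (foldr A (dual_alg i (gauss_word (rev w))) (rev u)) e0) =
  \sum_(0 <= k < size w) (nth i w k == i)%:R * (tau (take k w) * tau (drop k.+1 w ++ u)).
Proof.
elim/last_ind: w u => [|w a IH] u.
  rewrite big_geq // /gauss_word dual_alg_basis /=.
  by rewrite gauss_word0 hdot0l conjc0.
rewrite rev_rcons /= dual_alg_gauss emb_gauss_word.
rewrite addrC gauss_wordP hdotDl hdotZl addrC.
rewrite size_rcons big_nat_recr //= nth_rcons ltnn eqxx.
rewrite -!cats1 takel_cat // take_size [drop (size w).+1 _]drop_oversize ?size_cat ?addn1 //=.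
have -> : conjc (hdot (foldr A (A a (dual_alg i (gauss_word (rev w)))) (rev u)) e0 +
    (i == a)%:R * tau (rev w) * tau (rev u)) =
  conjc (hdot (foldr A (dual_alg i (gauss_word (rev w))) (rev (a :: u))) e0) +
    (i == a)%:R * (tau w * tau u).
  rewrite rmorphD /= !conjcM conjc_nat !tau_rev -mulrA rev_cons -cats1 foldr_cat //.
rewrite IH eq_sym; congr (_ + _); apply: eq_big_nat => k /andP[_ kw].
rewrite nth_cat kw takel_cat ?(ltnW kw) // drop_cat; case: ltnP => h; first by rewrite -catA.
have -> : k.+1 = size w by apply/eqP; rewrite eqn_leq kw.
by rewrite subnn drop_size.
Qed.



Lemma trace2_lin : linear (trace2 A e0 : ncpoly2 R d -> R[i]^o).
Proof. exact: mlin_is_linear. Qed.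

Lemma trace2_basis u v :
  trace2 A e0 (mkmalgU (FMonom u, FMonom v) 1) = tau u * tau v.
Proof. exact: (@mlin_basis _ _ R[i]^o (fun p => _ * _)). Qed.

Lemma conjugate_exists : conjugate_system A e0 xi.
Proof.
move=> i; elim/malg_basis_ind => [|[w]|a P Q IH IH'].
- by rewrite /nc_eval /fdq !linear0 hdot0l (lin0 trace2_lin).
- rewrite nc_eval_basis /fdq mlin_basis (@fdq_wordE _ _ i (FMonom w) w) //.
  rewrite big_mkcond (lin_sum trace2_lin).
  rewrite [LHS]adj_word hdotC -emb_gauss_word hdot_xi.
  rewrite (hdot_dual_word i [::] w); apply: eq_bigr => k _; rewrite cats0.
  case: eqP => _; first by rewrite mul1r trace2_basis.
  by rewrite mul0r (lin0 trace2_lin).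
- rewrite nc_evalP hdotDl hdotZl IH IH'.
  have -> : fdq i (a *: P + Q) = a *: fdq i P + fdq i Q by exact: mlin_is_linear.
  by rewrite trace2_lin.
Qed.

End Vector.

(** The defining relation fixes the pairing of xi_i with polynomials in A, hence with all words.
    This reduces claims about an arbitrary conjugate system to the one given by the series. *)
Lemma conjugate_unique (xi xi' : 'I_d -> F) :
  conjugate_system A e0 xi -> conjugate_system A e0 xi' -> xi = xi'.
Proof.
move=> h h'; apply/funext => i; apply: (span_sep (dense_eps M)) => -[w].
have [Q _ <-] := eps_nc_alg w.
elim/malg_basis_ind: Q => [|[v]|a P Q IH IH'].
- by rewrite /nc_eval !linear0.
- have hv z : hdot z (foldr A e0 v) = hdot (nc_eval A (mkmalgU (FMonom (rev v)) 1) z) e0.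
    by rewrite nc_eval_basis [RHS]adj_word revK.
  by rewrite nc_eval_basis !hv h h'.
- by rewrite nc_evalP !hdotDr !hdotZr IH IH'.
Qed.

End Conjugate.

(** * Operators on the tensor square *)

Section VNA.
Variables (R : realType) (V : hilbertType R) (G : set (V -> V)).
Local Notation N := (vna_generated G).

Lemma vna_generated_sub S : G S -> N S.
Proof. by move=> GS M _ GM; exact: GM. Qed.

Lemma vna_generated_id : N id.
Proof. by move=> M hM _; exact: vna_id. Qed.

Lemma vna_generated_lin (a : R[i]) S S' : N S -> N S' -> N (fun x => a *: S x + S' x).
Proof. by move=> h h' M hM GM; apply: vna_lin => //; [exact: h|exact: h']. Qed.

Lemma vna_generated_comp S S' : N S -> N S' -> N (fun x => S (S' x)).
Proof. by move=> h h' M hM GM; apply: (vna_comp hM); [exact: h|exact: h']. Qed.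

Lemma vna_generated_zero : N (fun=> 0).
Proof.
rewrite (_ : (fun=> 0) = (fun x : V => (-1) *: id x + id x)).
  exact: vna_generated_lin vna_generated_id vna_generated_id.
by apply/funext => x; rewrite scaleN1r addNr.
Qed.

(** The bounded operators themselves form a von Neumann algebra containing G. *)
Lemma vna_generated_bounded S :
  (forall S', G S' -> bounded_op S') -> N S -> bounded_op S.
Proof.
move=> hG h; apply: (h (@bounded_op R V V)) => //; split => //.
- exact: bounded_op_id.
- by move=> a S1 S2; exact: bounded_op_comb.
- by move=> S1 S2; exact: bounded_op_comp.
Qed.

(** Uniform limits are weak operator limits: the sum over the finitely many test pairs dominates
    each of them, so one n serves all. *)
Lemma vna_generated_limit (S : nat -> V -> V) (S' : V -> V) (C : R) :
  (forall n, N (S n)) -> bounded_op S' ->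
  (forall n x, rnorm (S n x - S' x) <= C * rnorm x * 2^-1 ^+ n) -> N S'.
Proof.
move=> hS bS hC M hM GM; apply: (vna_wot hM bS) => s e e0.
have [n hn] := half_pow_small (\sum_(p <- s) `|C| * rnorm p.1 * rnorm p.2) e0.
exists (S n); first exact: hS.
move=> p ps; rewrite rnormE ltcR; apply: le_lt_trans (hn n (leqnn _)).
apply: (le_trans (hdot_CS _ _)); rewrite rnorm_distC.
apply: (le_trans (ler_wpM2r (rnorm_ge0 _) (hC n p.1))).
rewrite mulrAC ler_wpM2r ?exprn_ge0 ?invr_ge0 // (big_rem _ ps) /=.
apply: (@le_trans _ _ (`|C| * rnorm p.1 * rnorm p.2)).
  by rewrite !ler_wpM2r ?rnorm_ge0 // ler_norm.
by rewrite lerDl sumr_ge0 // => p' _; rewrite !mulr_ge0 ?rnorm_ge0.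
Qed.

End VNA.

(* The norms s_n of S^n u are log-convex since S is symmetric, so s_1 > C s_0
   would force s_n to grow faster than C^n. *)
Lemma symmetric_extension (R : realType) (K : choiceType) (T : hilbertType R)
    (e : K -> T) (f : K -> K) (C : R) :
  0 <= C -> dense (range (mlin e)) ->
  (forall k m, hdot (e (f k)) (e m) = hdot (e k) (e (f m))) ->
  (forall k, exists c : R, forall n, rnorm (e (iter n f k)) <= C ^+ n * c) ->
  exists S, [/\ bounded_op S, forall x, rnorm (S x) <= C * rnorm x &
                forall k, S (e k) = e (f k)].
Proof.
move=> C0 de sym /choice[c hc].
pose h n : {linear malg K R[i] -> T} := mlin (fun k => e (iter n f k)).
have hle u : rnorm (h 1%N u) <= C * rnorm (h 0%N u).
  pose s n := rnorm (h n u).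
  have s0 n : 0 <= s n by exact: rnorm_ge0.
  pose B := \sum_(k <- msupp u) rnorm (mcoeff k u) * c k.
  have sB n : s n <= C ^+ n * B.
    rewrite /s /h /= /mlin; apply: (le_trans (rnorm_sum _ _)).
    rewrite /B mulr_sumr; apply: ler_sum => k _; rewrite rnormZ.
    by rewrite mulrCA ler_wpM2l ?rnorm_ge0.
  have slog n : s n.+1 ^+ 2 <= s n * s n.+2.
    apply: le_trans (hdot_CS _ _).
    suff -> : hdot (h n u) (h n.+2 u) = hdot (h n.+1 u) (h n.+1 u).
      by rewrite hdotxx rnorm_real ger0_norm // exprn_ge0 // rnorm_ge0.
    rewrite !hdot_mlin; apply: eq_bigr => k _; apply: eq_bigr => m _.
    by rewrite -sym.
  rewrite -/(s 1%N) -/(s 0%N) leNgt; apply/negP => lt.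
  have s0p : 0 < s 0%N.
    rewrite lt_neqAle s0 andbT eq_sym; apply/eqP => s00.
    have := slog 0%N; rewrite s00 mul0r leNgt exprn_gt0 //.
    by rewrite (le_lt_trans _ lt) // s00 mulr0.
  pose r := s 1%N / s 0%N.
  have Cr : C < r by rewrite ltr_pdivlMr.
  have r0 : 0 < r by exact: le_lt_trans C0 Cr.
  have grow n : 0 < s n /\ r * s n <= s n.+1.
    elim: n => [|n [sn IH]]; first by rewrite /r divfK // gt_eqF.
    have sn1 : 0 < s n.+1 by apply: lt_le_trans IH; rewrite mulr_gt0.
    split => //; rewrite -(ler_pM2l sn); apply: le_trans (slog n).
    by rewrite mulrCA mulrA expr2 ler_pM2r.
  have pow n : r ^+ n * s 0%N <= s n.
    elim: n => [|n IH]; first by rewrite expr0 mul1r.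
    apply: le_trans (grow n).2; rewrite exprS -mulrA ler_pM2l //.
  have Cr1 : C / r < 1 by rewrite ltr_pdivrMr // mul1r.
  have Cr0 : 0 <= C / r by rewrite divr_ge0 // ltW.
  have [n /(_ n (leqnn _))] := expr_small (2 * (B / s 0%N)) Cr0 Cr1.
  have : 1 <= B / s 0%N * (C / r) ^+ n.
    rewrite expr_div_n mulrACA -invfM ler_pdivlMr ?mul1r ?mulr_gt0 ?exprn_gt0 //.
    by rewrite mulrC [X in _ <= X]mulrC; exact: le_trans (sB n).
  by rewrite -mulrA; lra.
have [S [lS hS Se]] := extend_bounded de C0 hle.
exists S; split => //; first by apply/bounded_opP; split => //; exists C.
move=> k; have := Se (mkmalgU k 1); rewrite /h /=.
by rewrite (mlin_basis e) (mlin_basis (fun k => e (iter 1 f k))).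
Qed.

Section Tensor.
Variables (R : realType) (F T : hilbertType R) (tens : {bilinear F -> F -> T}).
Hypothesis tensor : hilbert_tensor tens.

Lemma rnorm_tens x y : rnorm (tens x y) = rnorm x * rnorm y.
Proof.
apply/eqP; rewrite -(@eqrXn2 _ 2) ?rnorm_ge0 ?mulr_ge0 ?rnorm_ge0 //; apply/eqP/complexI.
by rewrite -hdotxx tensor.1 !hdotxx exprMn [RHS]rmorphM.
Qed.

Let e (p : F * F) : T := tens p.1 p.2.

Lemma tens_dense : dense (range (mlin e)).
Proof.
suff -> : range (mlin e) = range (fun s : seq (F * F) => \sum_(p <- s) tens p.1 p.2).
  exact: tensor.2.
apply/seteqP; split => _ [x _ <-].
  exists [seq (mcoeff p x *: p.1, p.2) | p <- msupp x] => //.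
  by rewrite big_map; apply: eq_bigr => p _; rewrite linearZl_LR.
exists (\sum_(p <- x) mkmalgU p 1) => //.
rewrite linear_sum; apply: eq_bigr => p _; exact: mlin_basis.
Qed.

(** This is a (x) 1. Its bound on sums of elementary tensors does not follow from the bound on
    single ones; it comes from self-adjointness together with |a^n x| <= C^n |x|. *)
Lemma tens_opl (a : F -> F) (C : R) : 0 <= C -> adjoint a a ->
  (forall x, rnorm (a x) <= C * rnorm x) ->
  exists S, [/\ bounded_op S, forall t, rnorm (S t) <= C * rnorm t &
                forall x y, S (tens x y) = tens (a x) y].
Proof.
move=> C0 sa ha.
have [||S [bS hS eS]] := @symmetric_extension _ _ _ e (fun p => (a p.1, p.2)) C C0 tens_dense.
- by move=> k m; rewrite /e /= !tensor.1 sa.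
- move=> p; exists (rnorm p.1 * rnorm p.2) => n.
  suff [h1 h2] : rnorm (iter n (fun p : F * F => (a p.1, p.2)) p).1 <= C ^+ n * rnorm p.1 /\
      (iter n (fun p : F * F => (a p.1, p.2)) p).2 = p.2.
    by rewrite /e rnorm_tens h2 mulrA ler_wpM2r ?rnorm_ge0.
  elim: n => [|n [IH1 IH2]] /=; first by rewrite expr0 mul1r.
  split => //; apply: (le_trans (ha _)); by rewrite exprS -mulrA ler_wpM2l.
by exists S; split => // x y; have := eS (x, y).
Qed.

Lemma tens_opr (a : F -> F) (C : R) : 0 <= C -> adjoint a a ->
  (forall x, rnorm (a x) <= C * rnorm x) ->
  exists S, [/\ bounded_op S, forall t, rnorm (S t) <= C * rnorm t &
                forall x y, S (tens x y) = tens x (a y)].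
Proof.
move=> C0 sa ha.
have [||S [bS hS eS]] := @symmetric_extension _ _ _ e (fun p => (p.1, a p.2)) C C0 tens_dense.
- by move=> k m; rewrite /e /= !tensor.1 sa.
- move=> p; exists (rnorm p.1 * rnorm p.2) => n.
  suff [h1 h2] : rnorm (iter n (fun p : F * F => (p.1, a p.2)) p).2 <= C ^+ n * rnorm p.2 /\
      (iter n (fun p : F * F => (p.1, a p.2)) p).1 = p.1.
    by rewrite /e rnorm_tens h2 mulrCA ler_wpM2l ?rnorm_ge0.
  elim: n => [|n [IH1 IH2]] /=; first by rewrite expr0 mul1r.
  split => //; apply: (le_trans (ha _)); by rewrite exprS -mulrA ler_wpM2l.
by exists S; split => // x y; have := eS (x, y).
Qed.

End Tensor.

(** * Closability and the Lipschitz property *)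

(* [split_sum j f u w] is the sum of f (u ++ w1) w2 over the factorizations
   w = w1 j w2. *)
Fixpoint split_sum (I : eqType) (V : nmodType) (j : I)
    (f : seq I -> seq I -> V) (u w : seq I) : V :=
  if w is a :: w' then
    (if a == j then f u w' else 0) + split_sum j f (rcons u a) w'
  else 0.

Section SplitSum.
Variables (I : eqType) (V : nmodType) (j : I).
Implicit Types (f : seq I -> seq I -> V) (u v w : seq I).

Lemma eq_split_sum f g u w : (forall s t, f s t = g s t) ->
  split_sum j f u w = split_sum j g u w.
Proof. by move=> fg; elim: w u => //= a w IH u; rewrite IH fg. Qed.

Lemma split_sum_cat f u v w :
  split_sum j f u (v ++ w) =
  split_sum j (fun s t => f s (t ++ w)) u v + split_sum j f (u ++ v) w.
Proof.
elim: v u => [|a v IH] u /=; first by rewrite cats0 add0r.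
by rewrite IH cat_rcons addrA.
Qed.

Lemma split_sum_prefix f u v w :
  split_sum j f (u ++ v) w = split_sum j (fun s t => f (u ++ s) t) v w.
Proof. by elim: w v => //= a w IH v; rewrite rcons_cat IH. Qed.

Lemma split_sum_additive (W : nmodType) (g : V -> W) f u w :
  g 0 = 0 -> (forall x y, g (x + y) = g x + g y) ->
  g (split_sum j f u w) = split_sum j (fun s t => g (f s t)) u w.
Proof.
by move=> g0 gD; elim: w u => //= a w IH u; rewrite gD IH; case: eqP; rewrite ?g0.
Qed.

Lemma split_sumE f u w :
  \sum_(0 <= k < size w | nth j w k == j) f (u ++ take k w) (drop k.+1 w) =
  split_sum j f u w.
Proof.
elim: w u => [|a w IH] u; first by rewrite big_geq.
rewrite big_mkcond big_nat_recl //= cats0 drop0 -IH [in RHS]big_mkcond; congr (_ + _).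
by apply: eq_bigr => k _; rewrite cat_rcons.
Qed.

End SplitSum.

Section Lipschitz.
Variables (R : realType) (d : nat) (q : R) (F : hilbertType R).
Variable M : qfock d q F.
Hypothesis q_lt1 : `|q| < 1.
Implicit Types (i j a : 'I_d) (u v w : seq 'I_d) (x y : F).

Local Notation eps := (eps_ M).
Local Notation e0 := (eps_ M [::]).
Local Notation A := (gauss M).
Local Notation tau w := (hdot (foldr A e0 w) e0).

Definition rgauss j x := ar M j x + cr M j x.
Local Notation B := rgauss.

Lemma adj_rgauss j : adjoint (B j) (B j).
Proof.
move=> x y; rewrite /B hdotDl hdotDr adj_cr addrC; congr (_ + _).
exact: adjoint_sym (adj_cr M j) _ _.
Qed.

(** The two defects [l_i, R_a] = delta_ia q^N and [L_i, r_a] = - delta_ia q^N cancel. *)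
Lemma gauss_rgauss i a x : A i (B a x) = B a (A i x).
Proof.
rewrite /gauss /B (linD (bounded_op_lin (bal M i))) (linD (bounded_op_lin (bcl M i))).
rewrite (linD (bounded_op_lin (bar M a))) (linD (bounded_op_lin (bcr M a))).
rewrite al_ar al_cr cl_cr ar_cl.
move: (ar M a (al M i x)) (cr M a (al M i x)) (_ *: qth M x) (cl M i (ar M a x))
  (cr M a (cl M i x)) => u v t s w.
by rewrite -!addrA (addrCA v) (addrCA v s) (addrCA t).
Qed.

Lemma rgauss_vacuum a : B a e0 = A a e0.
Proof. by rewrite /gauss /B al_vacuum ar_vacuum cl_eps cr_eps. Qed.

Lemma gauss_word_rgauss w a x : foldr A (B a x) w = B a (foldr A x w).
Proof. by elim: w => //= b w ->; rewrite gauss_rgauss. Qed.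

(** B_a agrees with A_a on the vacuum and commutes with every A_i, so it appends a letter at the
    right end. *)
Lemma word_cat_rgauss u v : foldr A e0 (u ++ v) = foldr B (foldr A e0 u) (rev v).
Proof.
elim/last_ind: v => [|v a IH]; first by rewrite cats0.
by rewrite rev_rcons /= -IH -cats1 catA foldr_cat /= -rgauss_vacuum gauss_word_rgauss.
Qed.

Lemma adj_rword w x y : hdot (foldr B x w) y = hdot x (foldr B y (rev w)).
Proof.
elim: w x y => [|a w IH] x y //=.
by rewrite rev_cons -cats1 foldr_cat /= adj_rgauss IH.
Qed.

(** The outer letters pass to z as bounded operators: u by adjoints, v as right multiplications. *)
Lemma hdot_word_middle u w v z :
  hdot (foldr A e0 (u ++ w ++ v)) z = hdot (foldr A e0 w) (foldr B (foldr A z (rev u)) v).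
Proof. by rewrite foldr_cat adj_word word_cat_rgauss adj_rword revK. Qed.

(** Traciality of the vacuum state: right multiplication is moved across the inner product and
    returns as left multiplication. *)
Lemma tau_cyclic u v : tau (u ++ v) = tau (v ++ u).
Proof.
have := hdot_word_middle [::] u v e0; rewrite /= => ->.
have := word_cat_rgauss [::] (rev v); rewrite /= revK => <-.
by rewrite foldr_cat [RHS]adj_word.
Qed.

Section Vector.
Variable xi : 'I_d -> F.
Hypothesis xiE : forall i w, hdot (eps w) (xi i) = (phi q i [::] w)%:C.

Lemma hdot_word_xi j w :
  hdot (foldr A e0 w) (xi j) = split_sum j (fun s t => tau s * tau t : R[i]^o) [::] w.
Proof.
rewrite -emb_gauss_word (hdot_xi xiE).
have h u v : hdot (foldr A (dual_alg M j (gauss_word q v)) u) e0 =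
    split_sum j (fun s t => tau s * tau t : R[i]^o) u v.
  elim: v u => [|a v IH] u; first by rewrite dual_alg_basis /= gauss_word0 hdot0l.
  rewrite /= dual_alg_gauss emb_gauss_word [X in foldr A X u]addrC gauss_wordP hdotDl hdotZl.
  rewrite -[A a _]/(foldr A _ [:: a]) -foldr_cat cats1 IH; congr (_ + _).
  by rewrite eq_sym; case: eqP; rewrite ?mul0r // mul1r mulrC.
exact: (h [::]).
Qed.

(** h lists the values of a linear functional on the vectors A_w e0; the functionals met below are
    finite sums of single pairings. *)
Definition representable (h : seq 'I_d -> R[i]) :=
  exists z, forall w, h w = hdot (foldr A e0 w) z.

Lemma representable0 : representable (fun=> 0).
Proof. by exists 0 => w; rewrite hdot0r. Qed.

Lemma representableD h h' :
  representable h -> representable h' -> representable (fun w => h w + h' w).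
Proof. by move=> [z hz] [z' hz']; exists (z + z') => w; rewrite hdotDr hz hz'. Qed.

Lemma representableZ (c : R[i]) h : representable h -> representable (fun w => c * h w).
Proof. by move=> [z hz]; exists (conjc c *: z) => w; rewrite hdotZr conjcK hz. Qed.

Lemma representable_split_sum j u v (h : seq 'I_d -> seq 'I_d -> seq 'I_d -> R[i]) :
  (forall s t, representable (h s t)) ->
  representable (fun w => split_sum j (fun s t => h s t w : R[i]^o) u v).
Proof.
move=> hr; elim: v u => [|a v IH] u /=; first exact: representable0.
by apply: representableD (IH _); case: eqP => _ //; exact: representable0.
Qed.

Lemma representable_middle u v z :
  representable (fun w => hdot (foldr A e0 (u ++ w ++ v)) z).
Proof. by exists (foldr B (foldr A z (rev u)) v) => w; exact: hdot_word_middle. Qed.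

(* The Leibniz rule in u w v expresses the splittings inside w by those of the
   whole word, which <., xi_j> computes, and those inside u or v. *)
Lemma representable_inner j u v :
  representable (fun w => split_sum j (fun s t => tau (u ++ s) * tau (t ++ v) : R[i]^o) [::] w).
Proof.
pose f s t : R[i]^o := tau s * tau t.
have e w : split_sum j (fun s t => tau (u ++ s) * tau (t ++ v) : R[i]^o) [::] w =
    hdot (foldr A e0 (u ++ w ++ v)) (xi j) +
    ((-1) * split_sum j (fun s t => f s (t ++ w ++ v)) [::] u +
     (-1) * split_sum j (fun s t => f (u ++ w ++ s) t) [::] v).
  rewrite hdot_word_xi split_sum_cat split_sum_cat /=.
  have -> : split_sum j f (u ++ w) v = split_sum j (fun s t => f (u ++ w ++ s) t) [::] v.
    by rewrite -{1}[u ++ w]cats0 split_sum_prefix; apply: eq_split_sum => s t; rewrite catA.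
  have -> : split_sum j (fun s t => f s (t ++ v)) u w =
      split_sum j (fun s t => tau (u ++ s) * tau (t ++ v) : R[i]^o) [::] w.
    by rewrite -{1}[u]cats0 split_sum_prefix.
  by rewrite !mulN1r -opprD addrCA addrK.
have [z hz] : representable (fun w => hdot (foldr A e0 (u ++ w ++ v)) (xi j) +
    ((-1) * split_sum j (fun s t => f s (t ++ w ++ v)) [::] u +
     (-1) * split_sum j (fun s t => f (u ++ w ++ s) t) [::] v)); last first.
  by exists z => w; rewrite e hz.
apply: representableD; first exact: representable_middle.
apply: representableD; apply: representableZ.
  apply: representable_split_sum => s t; apply: representableZ.
  exact: representable_middle.
apply: representable_split_sum => s t.
have [z hz] := representableZ (tau t) (representable_middle u s e0).
by exists z => w; rewrite -hz /f mulrC.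
Qed.

Variables (T : hilbertType R) (tens : {bilinear F -> F -> T}).
Hypothesis tensor : hilbert_tensor tens.

Lemma fdq_evalP j (a : R[i]) (P Q : ncpoly R d) :
  fdq_eval A e0 tens j (a *: P + Q) =
  a *: fdq_eval A e0 tens j P + fdq_eval A e0 tens j Q.
Proof.
rewrite /fdq_eval.
have -> : fdq j (a *: P + Q) = a *: fdq j P + fdq j Q by exact: mlin_is_linear.
exact: mlin_is_linear.
Qed.

Lemma fdq_eval_basis j w :
  fdq_eval A e0 tens j (mkmalgU (FMonom w) 1) =
  split_sum j (fun s t => tens (foldr A e0 s) (foldr A e0 t)) [::] w.
Proof.
rewrite /fdq_eval /fdq mlin_basis (@fdq_wordE _ _ j (FMonom w) w) // linear_sum -split_sumE.
by apply: eq_bigr => k _; exact: mlin_basis.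
Qed.

(* The adjoint of d_j is defined at A_u e0 (x) A_v e0, with value z. *)
Lemma fdq_adjoint j u v : exists z, forall Q,
  hdot (fdq_eval A e0 tens j Q) (tens (foldr A e0 u) (foldr A e0 v)) =
  hdot (nc_eval A Q e0) z.
Proof.
have [z hz] := representable_inner j (rev u) (rev v).
exists z; elim/malg_basis_ind => [|[w]|a P Q IH IH'].
- by rewrite /fdq_eval /fdq /nc_eval !linear0 !hdot0l.
- rewrite nc_eval_basis fdq_eval_basis -[RHS]hz.
  rewrite (@split_sum_additive _ _ j R[i]^o (fun t => hdot t (tens (foldr A e0 u) (foldr A e0 v)))).
  + apply: eq_split_sum => s t; rewrite tensor.1 (tau_cyclic t) !foldr_cat.
    by rewrite [hdot (foldr A _ (rev u)) _]adj_word [hdot (foldr A _ (rev v)) _]adj_word !revK.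
  + by rewrite hdot0l.
  + by move=> x y; rewrite hdotDl.
- rewrite fdq_evalP nc_evalP !hdotDl !hdotZl.
  exact: (@eq_comb _ R[i]^o a _ _ _ _ IH IH').
Qed.

Lemma hdot_dense_zero (z : T) (f : F -> T) (C : R) : linear f ->
  (forall x, rnorm (f x) <= C * rnorm x) -> (forall w, hdot z (f (eps w)) = 0) ->
  forall x, hdot z (f x) = 0.
Proof.
move=> lf hC hz x; apply: rnorm0_eq0.
have C0 : 0 <= `|C| by [].
apply: (@le0_small _ _ (rnorm z * `|C|)) => c c0.
have [_ [t _ <-] xt] := dense_approx (dense_eps M) x c0.
have ht : hdot z (f (mlin (fun w : fmonom 'I_d => eps w) t)) = 0.
  rewrite (lin_sum lf) hdot_sumr big1 // => w _.
  by rewrite (linZ lf) hdotZr hz mulr0.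
rewrite -[hdot z _]subr0 -ht -hdotBr -(linB lf); apply: (le_trans (hdot_CS _ _)).
rewrite -mulrA ler_wpM2l ?rnorm_ge0 //; apply: (le_trans (hC _)).
apply: (le_trans (ler_wpM2r (rnorm_ge0 _) (ler_norm C))).
by rewrite ler_wpM2l // ltW.
Qed.

(** The adjoint of d_j is defined on the tensors A_u e0 (x) A_v e0, so a limit of derivatives of
    polynomials tending to 0 is orthogonal to them. That they span a dense subspace is used one leg
    at a time. *)
Lemma fdq_closable j : closable (fdq_graph A e0 tens j).
Proof.
move=> z hz.
have h0 u v : hdot z (tens (foldr A e0 u) (foldr A e0 v)) = 0.
  have [y hy] := fdq_adjoint j u v; set t := tens _ _ in hy *.
  apply: rnorm0_eq0; apply: (@le0_small _ _ (rnorm t + rnorm y)) => c c0.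
  have [_ [Q _ <-] /= []] := (closure_pairP _ _ _).1 hz c c0.
  rewrite subr0 => h1 h2.
  have -> : hdot z t = hdot (z - fdq_eval A e0 tens j Q) t + hdot (nc_eval A Q e0) y.
    by rewrite hdotBl -hy subrK.
  apply: (le_trans (rnormD _ _)); apply: (le_trans (lerD (hdot_CS _ _) (hdot_CS _ _))).
  rewrite mulrDl [rnorm t * _]mulrC [rnorm y * _]mulrC.
  rewrite lerD // ler_wpM2r ?rnorm_ge0 //; last exact: ltW.
  by rewrite rnorm_distC ltW.
have h1 u Q : hdot z (tens (foldr A e0 u) (nc_eval A Q e0)) = 0.
  elim/malg_basis_ind: Q => [|[v]|a P Q IH IH'].
  - by rewrite /nc_eval !linear0 ?hdot0r.
  - by rewrite nc_eval_basis h0.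
  - by rewrite nc_evalP linearPr hdotDr hdotZr IH IH' mulr0 addr0.
have h2 u Q : hdot z (tens (nc_eval A Q e0) (eps u)) = 0.
  have [P _ <-] := eps_nc_alg M u.
  elim/malg_basis_ind: Q => [|[v]|a Q Q' IH IH'].
  - by rewrite /nc_eval linear0 linear0l hdot0r.
  - by rewrite nc_eval_basis h1.
  - by rewrite nc_evalP linearPl hdotDr hdotZr IH IH' mulr0 addr0.
have h3 u y : hdot z (tens y (eps u)) = 0.
  apply: (@hdot_dense_zero z (fun y => tens y (eps u)) (rnorm (eps u))).
  - by move=> a x x'; rewrite linearPl.
  - by move=> x; rewrite (rnorm_tens tensor) mulrC.
  - by move=> w; have [P _ <-] := eps_nc_alg M w.
have h4 x y : hdot z (tens x y) = 0.
  apply: (@hdot_dense_zero z (fun y => tens x y) (rnorm x)).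
  - by move=> a x1 x'; rewrite linearPr.
  - by move=> x'; rewrite (rnorm_tens tensor).
  - by move=> w; rewrite h3.
apply: (dense_sep tensor.2) => _ [s _ <-].
by rewrite hdot0l hdot_sumr big1.
Qed.

End Vector.

(** * Operators that represent derivatives of polynomials *)

Section Series.
Variables (T : hilbertType R) (tens : {bilinear F -> F -> T}).
Hypothesis tensor : hilbert_tensor tens.

Local Notation N := (vna_tensor tens (vn_alg A) (vn_alg A)).
Local Notation ee := (tens e0 e0).

Lemma gauss_vn_alg a : vn_alg A (A a).
Proof. by apply: vna_generated_sub; exists a. Qed.

(** The operators are A_a (x) 1 and 1 (x) A_a; one constant for all letters keeps the loss over a
    word exponential in its length. *)
Lemma gauss_amplification : exists2 C : R, 0 <= C & forall a, exists Sl Sr : T -> T,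
  [/\ N Sl /\ N Sr, linear Sl, linear Sr,
      (forall t, rnorm (Sl t) <= C * rnorm t) /\ (forall t, rnorm (Sr t) <= C * rnorm t) &
      forall x y, Sl (tens x y) = tens (A a x) y /\ Sr (tens x y) = tens x (A a y)].
Proof.
have /choice[C hC] a : exists C : R, 0 <= C /\ forall x, rnorm (A a x) <= C * rnorm x.
  by have /bounded_opP[_ [C C0 h]] := bounded_gauss M a; exists C.
have Cle a : C a <= \sum_b C b.
  by rewrite (bigD1 a) //= lerDl sumr_ge0 // => b _; case: (hC b).
exists (\sum_a C a); first by rewrite sumr_ge0 // => b _; case: (hC b).
move=> a; have [Ca hA] := hC a.
have [Sl [bl hl el]] := tens_opl tensor Ca (adj_gauss M a) hA.
have [Sr [br hr er]] := tens_opr tensor Ca (adj_gauss M a) hA.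
exists Sl, Sr; split.
- split; apply: vna_generated_sub; split => //.
    exists (A a), id; split => //; first exact: gauss_vn_alg.
    exact: vna_generated_id.
  exists id, (A a); split => //; last exact: gauss_vn_alg.
  exact: vna_generated_id.
- exact: bounded_op_lin bl.
- exact: bounded_op_lin br.
- split=> t; [apply: (le_trans (hl t))|apply: (le_trans (hr t))];
  by rewrite ler_wpM2r ?rnorm_ge0.
- by [].
Qed.

Lemma fdq_eval_var j a (Sl : T -> T) Q : linear Sl ->
  (forall x y, Sl (tens x y) = tens (A a x) y) ->
  fdq_eval A e0 tens j (ncvar R a * Q) =
  (a == j)%:R *: tens e0 (nc_eval A Q e0) + Sl (fdq_eval A e0 tens j Q).
Proof.
move=> lS hS; elim/malg_basis_ind: Q => [|[w]|c P Q IH IH'].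
- rewrite mulr0 /fdq_eval /fdq /nc_eval !linear0 (lin0 lS) ?scaler0 ?addr0 //.
- rewrite ncvar_mulU !fdq_eval_basis nc_eval_basis /=; congr (_ + _).
    by case: eqP; rewrite ?scale1r ?scale0r.
  rewrite (split_sum_additive _ _ _ _ (lin0 lS) (linD lS)).
  rewrite -[[:: a]]cats0 split_sum_prefix; apply: eq_split_sum => s t.
  by rewrite hS.
- rewrite [_ * _]malg_mulP [LHS]fdq_evalP [in RHS]nc_evalP [in RHS]fdq_evalP lS linearPr.
  have -> (b : R[i]) (x y x' y' : T) : b *: (c *: x + y) + (c *: x' + y') =
      c *: (b *: x + x') + (b *: y + y').
    by rewrite !scalerDr addrACA !scalerA mulrC.
  exact: eq_comb IH IH'.
Qed.

(* The second operator S2, which is 1 (x) Q(A), is carried along since the Leibniz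
   rule for A_a Q involves it. *)
Definition good j y (k : R) := exists (Q : ncpoly R d) (S1 S2 : T -> T),
  [/\ nc_eval A Q e0 = y, N S1 /\ N S2,
      S1 ee = fdq_eval A e0 tens j Q /\ S2 ee = tens e0 y,
      forall t, rnorm (S1 t) <= k * rnorm t & forall t, rnorm (S2 t) <= k * rnorm t].

Lemma good_le j y k k' : k <= k' -> good j y k -> good j y k'.
Proof.
move=> kk' [Q [S1 [S2 [h1 h2 h3 h4 h5]]]]; exists Q, S1, S2; split => // t.
  by apply: (le_trans (h4 t)); rewrite ler_wpM2r ?rnorm_ge0.
by apply: (le_trans (h5 t)); rewrite ler_wpM2r ?rnorm_ge0.
Qed.

Lemma good0 j : good j 0 0.
Proof.
exists 0, (fun=> 0), (fun=> 0); split.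
- by rewrite /nc_eval linear0.
- by split; exact: vna_generated_zero.
- by rewrite /fdq_eval /fdq !linear0.
- by move=> t; rewrite rnorm0 mul0r.
- by move=> t; rewrite rnorm0 mul0r.
Qed.

Lemma goodP j (r : R) y y' k k' :
  good j y k -> good j y' k' -> good j (r%:C *: y + y') (`|r| * k + k').
Proof.
move=> [Q [S1 [S2 [h1 [n1 n2] [e1 e2] b1 b2]]]] [Q' [S1' [S2' [h1' [n1' n2'] [e1' e2'] b1' b2']]]].
exists (r%:C *: Q + Q'), (fun t => r%:C *: S1 t + S1' t), (fun t => r%:C *: S2 t + S2' t); split.
- by rewrite nc_evalP h1 h1'.
- by split; exact: vna_generated_lin.
- by rewrite fdq_evalP linearPr e1 e1' e2 e2'.
- move=> t; apply: (le_trans (rnormD _ _)); rewrite rnormZr mulrDl -mulrA.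
  by rewrite lerD // ler_wpM2l.
- move=> t; apply: (le_trans (rnormD _ _)); rewrite rnormZr mulrDl -mulrA.
  by rewrite lerD // ler_wpM2l.
Qed.

Lemma good_vacuum j : good j e0 1.
Proof.
exists (mkmalgU (FMonom [::]) 1), (fun=> 0), id; split.
- by rewrite nc_eval_basis.
- by split; [exact: vna_generated_zero|exact: vna_generated_id].
- by rewrite fdq_eval_basis.
- by move=> t; rewrite rnorm0 mul1r rnorm_ge0.
- by move=> t; rewrite mul1r.
Qed.

Lemma good_gauss : exists2 C : R, 0 <= C &
  forall j a y k, good j y k -> good j (A a y) ((C + 1) * k).
Proof.
have [C C0 hC] := gauss_amplification; exists C => // j a y k.
move=> [Q [S1 [S2 [h1 [n1 n2] [e1 e2] b1 b2]]]].
have [Sl [Sr [[nl nr] ll lr' [bl br'] hS]]] := hC a.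
(* Leibniz rule: d_j (x_a Q) = delta_aj 1 (x) Q + (x_a (x) 1) d_j Q. The first term costs 1 and the
   second C. *)
exists (ncvar R a * Q), (fun t => (a == j)%:R *: S2 t + Sl (S1 t)), (fun t => Sr (S2 t)); split.
- by rewrite nc_eval_var ?h1 //; exact: gauss_lin.
- split; last exact: vna_generated_comp nr n2.
  exact: vna_generated_lin n2 (vna_generated_comp nl n1).
- split; last by rewrite e2 (hS _ _).2.
  by rewrite (@fdq_eval_var j a Sl) // ?e1 ?e2 ?h1 // => x z; rewrite (hS x z).1.
- move=> t; apply: (le_trans (rnormD _ _)); rewrite mulrDl mul1r addrC mulrDl.
  rewrite lerD //; first by rewrite -mulrA; apply: (le_trans (bl _)); rewrite ler_wpM2l.
  case: eqP => _; first by rewrite scale1r.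
  by rewrite scale0r rnorm0; exact: le_trans (rnorm_ge0 _) (b2 t).
- move=> t; rewrite -mulrA mulrDl mul1r; apply: (@le_trans _ _ (C * (k * rnorm t))).
    by apply: (le_trans (br' _)); rewrite ler_wpM2l.
  by rewrite lerDl; exact: le_trans (rnorm_ge0 _) (b2 t).
Qed.

Lemma good_eps j : exists2 K : R, 0 <= K & forall w, good j (eps w) (K ^+ size w).
Proof.
have [C C0 hC] := good_gauss.
have q1 : 0 <= (1 - `|q|)^-1 by rewrite invr_ge0 subr_ge0 ltW.
(* From e_(aw) = A_a e_w - l_a e_w: C + 1 pays for the first term and 1 / (1 - |q|) for the second,
   whose shorter words are raised to the exponent |w| by K >= 1. *)
pose K := C + 1 + (1 - `|q|)^-1.
have K1 : 1 <= K by rewrite /K addrAC lerDr addr_ge0.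
have K0 : 0 <= K := le_trans ler01 K1.
exists K => // w.
elim: {w}(size w) {-2}w (leqnn (size w)) => [|n IH] w wn.
  by move: wn; rewrite leqn0 size_eq0 => /eqP ->; rewrite expr0; exact: good_vacuum.
case: w wn => [|a w] wn; first by rewrite expr0; exact: good_vacuum.
have hw : good j (A a (eps w)) ((C + 1) * K ^+ size w) by apply/hC/IH.
have ha : good j (al M a (eps w)) ((1 - `|q|)^-1 * K ^+ size w).
  case: w wn {hw} => [|b w] wn.
    rewrite al_vacuum; apply: good_le (good0 j); by rewrite expr0 mulr1.
  have hc := comb_al q_lt1 a (comb_eps M (b :: w)).
  rewrite mulr1 in hc.
  apply: (@good_le _ _ (K ^+ size w * (1 - `|q|)^-1)).
    by rewrite mulrC ler_wpM2l // exprS ler_peMl // exprn_ge0.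
  apply: (comb_rec (G := good j)) hc.
  - by move=> x k k'; exact: good_le.
  - exact: good0.
  - by move=> r x x' k k'; exact: goodP.
  - by rewrite exprn_ge0.
  - move=> v vw; have {}vw : size v = size w by [].
    by rewrite -vw; apply: IH; rewrite vw; exact: ltnW wn.
have := goodP (-1) ha hw; rewrite rmorphN rmorph1 scaleN1r normrN1 mul1r.
rewrite {1}/gauss addKr cl_eps => h; apply: good_le h.
by rewrite -mulrDl exprS ler_wpM2r ?exprn_ge0 // /K addrC.
Qed.

(** Each y n is a polynomial in A whose derivative is an operator of norm O(2^-n) applied to e0 (x)
    e0, because [cq] outruns both k^n and the exponential loss of [good_eps]. The operators
    therefore sum in norm, and partial sums of polynomials and of derivatives converge together. *)
Lemma lipschitz_series j (k Q : R) (y : nat -> F) (x : F) : 0 <= k ->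
  (forall n, comb M n (`|cq q n./2| * k ^+ n) (y n)) ->
  (forall n, rnorm (\sum_(m < n) y m - x) <= Q * 2^-1 ^+ n) ->
  exists2 S, N S & closure (fdq_graph A e0 tens j) (x, S ee).
Proof.
move=> k0 hy hx; have [K K0 hK] := good_eps j.
have [C hC] := cq_small q_lt1 (mulr_ge0 k0 K0).
have /choice[P /choice[S1 hS]] n : exists P S1,
    [/\ nc_eval A P e0 = y n, N S1, S1 ee = fdq_eval A e0 tens j P &
        forall t, rnorm (S1 t) <= C * 2^-1 ^+ n * rnorm t].
  have : good j (y n) (C * 2^-1 ^+ n).
    apply: good_le (hC n) _; rewrite exprMn mulrA mulrC.
    apply: (comb_rec (G := good j)) (hy n).
    - by move=> z l l'; exact: good_le.
    - exact: good0.
    - by move=> r z z' l l'; exact: goodP.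
    - by rewrite exprn_ge0.
    - by move=> v <-; exact: hK.
  by move=> [P [S1 [S2 [h1 [n1 _] [e1 _] b1 _]]]]; exists P, S1.
pose SS n t := \sum_(m < n) S1 m t.
have NS n : N (SS n).
  elim: n => [|n IH].
    rewrite (_ : SS 0%N = fun=> 0); first exact: vna_generated_zero.
    by apply/funext => t; rewrite /SS big_ord0.
  rewrite (_ : SS n.+1 = fun t => 1 *: S1 n t + SS n t).
    by apply: vna_generated_lin IH; case: (hS n).
  by apply/funext => t; rewrite /SS big_ord_recr scale1r addrC.
have SSee n : SS n ee = fdq_eval A e0 tens j (\sum_(m < n) P m) /\
    nc_eval A (\sum_(m < n) P m) e0 = \sum_(m < n) y m.
  elim: n => [|n [IH IH']].
    by rewrite /SS !big_ord0 /fdq_eval /fdq /nc_eval !linear0.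
  have [h1 _ h3 _] := hS n.
  have -> : \sum_(m < n.+1) P m = 1 *: P n + \sum_(m < n) P m.
    by rewrite big_ord_recr scale1r addrC.
  rewrite fdq_evalP nc_evalP !scale1r IH' h1 -IH -h3 /SS !big_ord_recr /=.
  by split; rewrite addrC.
have /choice[S hlim] t : exists s, forall n, rnorm (SS n t - s) <= 2 * (C * rnorm t) * 2^-1 ^+ n.
  apply: (@cauchy_geometric _ _ (fun n => SS n t)) => n.
  rewrite /SS big_ord_recr addrC addKr /=; have [_ _ _ h] := hS n.
  by apply: (le_trans (h t)); rewrite mulrAC.
have C0 : 0 <= C.
  have := hC 0%N; rewrite !expr0 !mulr1 /= normr1; exact: le_trans.
have lSS n : linear (SS n).
  by apply: bounded_op_lin; apply: vna_generated_bounded (NS n) => ? [].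
have hlim' t n : rnorm (SS n t - S t) <= 2 * C * rnorm t * 2^-1 ^+ n.
  by have := hlim t n; rewrite mulrA.
have bS : bounded_op S.
  apply/bounded_opP; split; last first.
    exists (2 * C) => [|t]; first by rewrite mulr_ge0.
    by have := hlim' t 0%N; rewrite /SS big_ord0 sub0r rnormN expr0 mulr1.
  move=> a s t; apply/eqP; rewrite -subr_eq0; apply/eqP/rnorm0_eq0.
  apply: (@le0_small _ _ (rnorm a * (2 * C * rnorm s) + 2 * C * rnorm t +
    2 * C * rnorm (a *: s + t))) => c c0.
  have [n hn] := half_pow_small 1 c0.
  have {}hn : 2^-1 ^+ n <= c by rewrite ltW // -[X in X < _]mul1r hn.
  have hc z : rnorm (SS n z - S z) <= 2 * C * rnorm z * c.
    by apply: (le_trans (hlim' z n)); rewrite ler_wpM2l // !mulr_ge0 ?rnorm_ge0.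
  have -> : S (a *: s + t) - (a *: S s + S t) =
      a *: (SS n s - S s) + (SS n t - S t) - (SS n (a *: s + t) - S (a *: s + t)).
    rewrite lSS scalerBr opprB [X in _ = X + _]addrACA -opprD [in RHS]addrC.
    by rewrite -addrA [X in _ = _ + X]addrC subrK addrC.
  apply: (le_trans (rnormB _ _)); rewrite [_ * c]mulrDl lerD //.
  apply: (le_trans (rnormD _ _)); rewrite rnormZ mulrDl lerD //.
  by rewrite -[X in _ <= X]mulrA ler_wpM2l ?rnorm_ge0.
exists S; first exact: vna_generated_limit NS bS (fun n t => hlim' t n).
apply/closure_pairP => c c0.
have [n hn] := half_pow_small (`|Q| + 2 * C * rnorm ee) c0.
have {}hn := hn n (leqnn n).
have p0 : 0 <= 2^-1 ^+ n :> R by rewrite exprn_ge0 // invr_ge0.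
exists (nc_eval A (\sum_(m < n) P m) e0, fdq_eval A e0 tens j (\sum_(m < n) P m)).
  by exists (\sum_(m < n) P m).
have [<- ->] := SSee n; split; apply: le_lt_trans hn => /=.
  apply: (le_trans (hx n)); rewrite ler_wpM2r // (le_trans (ler_norm Q)) //.
  by rewrite lerDl !mulr_ge0 ?rnorm_ge0.
by apply: (le_trans (hlim' _ n)); rewrite ler_wpM2r // lerDr.
Qed.

End Series.

End Lipschitz.

Theorem theorem1p1 (R : realType) (d : nat) (q : R) (F : hilbertType R)
    (iota : {linear fock_alg R d -> F}) (A : 'I_d -> F -> F) :
  (0 < d)%N -> -1 < q -> q < 1 ->
  q_fock_space q iota -> q_gaussians iota A ->
  let e0 := iota (fock_basis R mone) in
  [/\ exists D, normalized_dual_system A e0 D,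
      exists xi, conjugate_system A e0 xi &
      forall (xi : 'I_d -> F) (T : hilbertType R) (tens : {bilinear F -> F -> T}),
        conjugate_system A e0 xi -> hilbert_tensor tens ->
        lipschitz_conjugate A e0 tens xi].
Proof.
move=> d0 qN1 q1 hF hA.
have [M [eM AM]] := qfock_exists d0 hF hA.
have q_lt1 : `|q| < 1 by rewrite ltr_norml qN1.
have -> : A = gauss M by apply/funext => i; apply/funext => x; exact: AM.
move=> e0; have {e0}-> : e0 = eps_ M [::] by rewrite /e0 -eM fm1.
(* Both descriptions of xi_i are kept: its values on words give the dual and the conjugate system,
   its series the Lipschitz property. *)
have /choice[xi hxi] i : exists xi : F, (exists (k Q : R) (y : nat -> F),
    [/\ 0 <= k, forall n, comb M n (`|cq q n./2| * k ^+ n) (y n) &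
        forall n, rnorm (\sum_(m < n) y m - xi) <= Q * 2^-1 ^+ n]) /\
    forall w, hdot (eps_ M w) xi = (phi q i [::] w)%:C.
  have [k [Q [y [xi [h1 h2 h3 h4]]]]] := dual_vector M q_lt1 i.
  by exists xi; split => //; exists k, Q, y.
have xiE i w : hdot (eps_ M w) (xi i) = (phi q i [::] w)%:C by case: (hxi i).
split.
- exact (dual_system_exists q_lt1 xiE).
- by exists xi; exact: conjugate_exists xiE.
move=> xi' T tens hxi' tensor j.
have -> : xi' = xi by exact: conjugate_unique hxi' (conjugate_exists xiE).
split; first exact (fdq_closable xiE tensor (j := j)).
move=> i; have [[k [Q [y [h1 h2 h3]]]] _] := hxi i.
exact (lipschitz_series q_lt1 tensor j h1 h2 h3).
Qed.
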